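(* A finitely generated group $\Gamma$ is hyperbolic if and only if one (equivalently, every) Cayley action of $\Gamma$, i.e. its action by left translation on $\operatorname{Cay}(\Gamma,S)$ for a finite generating set $S$, has the $\rho$-Cotlar property for some $\rho>0$. In the converse direction, it is enough that, for some $\rho>0$, the $(\rho,m_k)$-Cotlar property hold along an increasing sequence of positive integers $(m_k)_{k\ge1}$ with $m_k\to\infty$ and $\sup_{k\ge1}m_{k+1}/m_k<\infty$.
   Context: The Cayley graph $X=\operatorname{Cay}(\Gamma,S)$ is viewed as a geodesic metric space with every edge of length one, with base point $o=e$ (the identity). $|x|=\operatorname{dist}(o,x)$; $S_m(o)=\{x\in X:|x|=m\}$; $B_r(a)=\{x:\operatorname{dist}(x,a)<r\}$ for $r>0$, $B_0(a)=\{a\}$. $\Gamma$ is hyperbolic if $X$ is $\delta$-hyperbolic for some $\delta$: every side of every geodesic triangle lies in the open $\delta$-neighborhood of the union of the other two sides. For $A\subset X$ and $r\ge0$, $\mathcal L^{\exists}_A=\{g\in\Gamma:\text{some geodesic from } o \text{ to } g.o \text{ meets } A\}$ and $\mathcal L^{\forall,r}_A=\{g\in\Gamma:\text{there exists } a\in A \text{ such that every geodesic from } o\text{ to } g.o\text{ meets } B_r(a)\}$. $\lambda$ is the left regular representation of $\Gamma$; $P_{\mathcal E}$ (for $\mathcal E\subset\Gamma$) is the Fourier projection with $P_{\mathcal E}\lambda_g=\lambda_g$ if $g\in\mathcal E$ and $0$ otherwise; $\mathcal E^{-1}=\{g^{-1}:g\in\mathcal E\}$. For $\mathcal A=(A_i)_{i\in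 I}$ and finitely supported $\varepsilon=(\varepsilon_i)$ with $|\varepsilon_i|\le1$, $$\mathcal H^{\exists}_{\mathcal A,\varepsilon}=\sum_i\varepsilon_iP_{\mathcal L^{\exists}_{A_i}},\quad (\mathcal H^{\exists}_{\mathcal A,\varepsilon})^\circ=\sum_i\overline{\varepsilon_i}P_{(\mathcal L^{\exists}_{A_i})^{-1}},\quad \mathcal H^{\forall,r}_{\mathcal A,\varepsilon}=\sum_i\varepsilon_iP_{\mathcal L^{\forall,r}_{A_i}},\quad (\mathcal H^{\forall,r}_{\mathcal A,\varepsilon})^\circ=\sum_i\overline{\varepsilon_i}P_{(\mathcal L^{\forall,r}_{A_i})^{-1}}.$$ For $\rho\ge0$ and $m\in\mathbb N$, the action has the $(\rho,m)$-Cotlar property if, for every finite family $(A_i)_{i\in I}$ of subsets of $S_m(o)$ with $\mathcal L^{\forall,\rho}_{A_i}\cap\mathcal L^{\forall,\rho}_{A_j}=\varnothing$ for $i\ne j$, every choice $|\varepsilon_i|\le1$, and every $g,h\in\bigcup_i\mathcal L^{\exists}_{A_i}$ with $|gh^{-1}.o|\ge2m+2\rho$, one has, with $H^{\exists}=\mathcal H^{\exists}_{\mathcal A,\varepsilon}$ and $H^{\forall}=\mathcal H^{\forall,\rho}_{\mathcal A,\varepsilon}$, $$\begin{aligned}H^{\exists}(\lambda_g)(H^{\exists})^\circ(\lambda_{h^{-1}})&=H^{\forall}\big(\lambda_g(H^{\forall})^\circ(\lambda_{h^{-1}})\big)+(H^{\forall})^\circ\big(H^{\forall}(\lambda_g)\lambda_{h^{-1}}\big)-(H^{\forall})^\circ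 H^{\forall}(\lambda_g\lambda_{h^{-1}})\\&=H^{\forall}\big(\lambda_g(H^{\exists})^\circ(\lambda_{h^{-1}})\big)+(H^{\forall})^\circ\big(H^{\exists}(\lambda_g)\lambda_{h^{-1}}\big)-(H^{\forall})^\circ H^{\forall}(\lambda_g\lambda_{h^{-1}}).\end{aligned}$$ The action has the $\rho$-Cotlar property if it has the $(\rho,m)$-Cotlar property for every $m\in\mathbb N$. *)

(* Defs.v *)
From HB Require Import structures.
From mathcomp Require Import all_boot all_order all_algebra ring lra.
From mathcomp Require Import complex.
From mathcomp Require Import all_classical all_reals all_analysis.

Set Implicit Arguments.
Unset Strict Implicit.
Unset Printing Implicit Defensive.

Import Order.TTheory GRing.Theory Num.Theory.

Local Open Scope classical_set_scope.
Local Open Scope ring_scope.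

Section MetricGeometry.
Variables (R : realType) (X : Type) (d : X -> X -> R).

(* Only the values of [gamma] on [[0, d x y]] are relevant. *)
Definition geodesic (x y : X) (gamma : R -> X) : Prop :=
  [/\ gamma 0 = x, gamma (d x y) = y &
      forall s t : R, 0 <= s <= d x y -> 0 <= t <= d x y ->
        d (gamma s) (gamma t) = `|s - t|].

Definition trace (x y : X) (gamma : R -> X) : set X :=
  gamma @` [set t : R | 0 <= t <= d x y].

Definition open_neighborhood (r : R) (A : set X) : set X :=
  [set x | exists2 a, A a & d x a < r].

Definition delta_hyperbolic (delta : R) : Prop :=
  forall (x y z : X) (a b c : R -> X),
    geodesic x y a -> geodesic y z b -> geodesic z x c ->
    [/\ trace x y a `<=`
          open_neighborhood delta (trace y z b `|` trace z x c),
        trace y z b `<=`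
          open_neighborhood delta (trace z x c `|` trace x y a) &
        trace z x c `<=`
          open_neighborhood delta (trace x y a `|` trace y z b)].

Definition metric_ball (r : R) (a : X) : set X :=
  if r == 0 then [set a] else [set x | d x a < r].

Definition metric_sphere (o : X) (m : nat) : set X := [set x | d o x = m%:R].

Definition meets (x y : X) (gamma : R -> X) (A : set X) : Prop :=
  trace x y gamma `&` A !=set0.

End MetricGeometry.

Section RegularRepresentation.
Variables (R : realType) (G : groupType).

Definition square_summable : {pred (G -> R[i]^o)} :=
  fun f => `[< (\esum_(x in [set: G])
                  (Normc.normc (f x) ^+ 2)%:E < +oo)%E >].

Lemma square_summableP (f : G -> R[i]^o) : f \in square_summable <->
  (\esum_(x in [set: G]) (Normc.normc (f x) ^+ 2)%:E < +oo)%E.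
Proof. by split=> [/asboolP|hf]; [|exact/asboolP]. Qed.

Lemma square_summable_closed : GRing.subsemimod_closed square_summable.
Proof.
have nE (z : R[i]) : Normc.normc z ^+ 2 = complex.Re z ^+ 2 + complex.Im z ^+ 2.
  by case: z => a b /=; rewrite sqr_sqrtr// addr_ge0 ?sqr_ge0.
have n0 (z : R[i]) : 0 <= Normc.normc z ^+ 2 by exact: sqr_ge0.
have ineq (u v : R[i]) : Normc.normc (u + v) ^+ 2 <=
    (Normc.normc u ^+ 2 + Normc.normc u ^+ 2) +
    (Normc.normc v ^+ 2 + Normc.normc v ^+ 2) :> R.
  rewrite !nE; case: u v => [a b] [c e] /=.
  by have := sqr_ge0 (a - c); have := sqr_ge0 (b - e); nra.
split=> [|a f]; last first.
  move=> /square_summableP hf; apply/square_summableP.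
  have hn (n : nat) : (\esum_(x in [set: G])
      (n%:R * Normc.normc (f x) ^+ 2)%:E < +oo)%E.
    elim: n => [|n IH].
      by rewrite esum1 ?ltry// => x _; rewrite mul0r.
    under eq_esum do rewrite -natr1 mulrDl mul1r EFinD.
    rewrite esumD => [|x _|x _]; [|by rewrite lee_fin mulr_ge0|by rewrite lee_fin].
    exact: (lte_add_pinfty IH hf).
  apply: le_lt_trans (hn (Num.bound (Normc.normc a ^+ 2))).
  apply: le_esum => x _; rewrite lee_fin Normc.normcM exprMn ler_wpM2r//.
  exact/ltW/archi_boundP.
split=> [|f g].
  apply/square_summableP; rewrite esum1 ?ltry// => x _.
  by rewrite nE /= expr0n /= addr0.
move=> /square_summableP hf /square_summableP hg; apply/square_summableP.
apply: (@le_lt_trans _ _ (\esum_(x in [set: G])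
    (((Normc.normc (f x) ^+ 2)%:E + (Normc.normc (f x) ^+ 2)%:E) +
     ((Normc.normc (g x) ^+ 2)%:E + (Normc.normc (g x) ^+ 2)%:E)))%E).
  by apply: le_esum => x _; rewrite -!EFinD lee_fin; exact: ineq.
have q1 x : (0 <= (Normc.normc (f x) ^+ 2)%:E)%E by rewrite lee_fin.
have q2 x : (0 <= (Normc.normc (g x) ^+ 2)%:E)%E by rewrite lee_fin.
by rewrite !esumD ?lte_add_pinfty// => x _; rewrite adde_ge0.
Qed.

HB.instance Definition _ :=
  GRing.isSubmodClosed.Build R[i] (G -> R[i]^o) square_summable
    square_summable_closed.

Record l2 := L2 { l2_fun :> G -> R[i]^o; _ : l2_fun \in square_summable }.

HB.instance Definition _ := [isSub for l2_fun].
HB.instance Definition _ := [Choice of l2 by <:].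
HB.instance Definition _ := [SubChoice_isSubZmodule of l2 by <:].
HB.instance Definition _ := [SubZmodule_isSubLmodule of l2 by <:].

Lemma l2_deltaP (g : G) :
  (fun x => (x == g)%:R : R[i]^o) \in square_summable.
Proof.
apply/square_summableP.
rewrite (@esumID R G [set g])//= ?setTI; last first.
  by move=> x _; rewrite lee_fin sqr_ge0.
rewrite esum_set1 ?lee_fin ?sqr_ge0// esum1 ?adde0 ?ltry// => x /= /eqP.
by move=> /negPf ->; rewrite Normc.normc0 expr0n.
Qed.

Definition l2_delta (g : G) : l2 := L2 (l2_deltaP g).

Lemma left_translateP (g : G) (f : l2) :
  (fun x => f (g^-1 * x)%g) \in square_summable.
Proof.
have /square_summableP hf := valP f; apply/square_summableP => /=.
rewrite (reindex_esum [set: G] _ (fun x : G => (g^-1 * x)%g)) in hf.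
  exact: hf.
split=> // [x y _ _|x _] /=; first exact: mulgI.
by exists (g * x)%g => //; rewrite mulKg.
Qed.

Definition lambda (g : G) : l2 -> l2 := fun f => L2 (left_translateP g f).

Definition fourier_coef (T : l2 -> l2) (g : G) : R[i] := T (l2_delta 1%g) g.

(* Meaningful on the linear span of the [lambda g], where only finitely many
   Fourier coefficients are nonzero. *)
Definition fourier_proj (E : set G) (T : l2 -> l2) : l2 -> l2 :=
  \sum_(g \in E) fourier_coef T g *: lambda g.

Lemma fourier_coef_lambda (g h : G) :
  fourier_coef (lambda g) h = (g == h)%:R.
Proof.
by rewrite /fourier_coef /= -(inj_eq (mulgI g)) mulgA mulgV mul1g mulg1 eq_sym.
Qed.

Lemma fourier_proj_lambda (E : set G) (g : G) :
  fourier_proj E (lambda g) = if g \in E then lambda g else 0.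
Proof.
rewrite /fourier_proj; under eq_fsbigr do rewrite fourier_coef_lambda.
case: ifPn => [/set_mem Eg|/negP Eg].
  rewrite -(fsbig_widen [set g]) ?fsbig_set1 ?eqxx ?scale1r//.
  - by move=> _ ->.
  - by move=> h [_ /= /eqP]; rewrite eq_sym => /negPf ->; rewrite scale0r.
rewrite fsbig1// => h Eh; case: eqP => [gh|]; last by rewrite scale0r.
by case: Eg; rewrite gh; exact: mem_set.
Qed.

Lemma fourier_proj_sum (E : set G) (s : seq G) (c : G -> R[i]) :
  fourier_proj E (\sum_(g <- s) c g *: lambda g) =
  \sum_(g <- s) c g *: fourier_proj E (lambda g).
Proof.
have coefE h : fourier_coef (\sum_(g <- s) c g *: lambda g) h =
    \sum_(g <- s) c g * (g == h)%:R.
  elim: s => [|g s IH]; first by rewrite !big_nil.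
  by rewrite !big_cons -IH -fourier_coef_lambda.
rewrite {1}/fourier_proj (fsbigE [seq h <- undup s | h \in E]).
- rewrite big_filter_cond (eq_bigl (fun h => h \in E)); last first.
    by move=> h /=; rewrite andbb.
  under eq_bigr do rewrite coefE scaler_suml.
  rewrite exchange_big/=; apply: eq_big_seq => g gs.
  rewrite fourier_proj_lambda big_mkcond (bigD1_seq g) ?undup_uniq ?mem_undup//=.
  rewrite eqxx mulr1 big1 ?addr0; first by case: ifP => // _; rewrite scaler0.
  by move=> h /negPf; rewrite eq_sym => ->; rewrite mulr0 scale0r if_same.
- by rewrite filter_uniq ?undup_uniq.
- by move=> h /=; rewrite mem_filter => /andP[/set_mem].
- move=> h Eh; rewrite mem_filter mem_undup mem_set//= => hs.
  rewrite coefE big_seq big1 ?scale0r// => g gs.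
  by case: eqP gs hs => [-> ->|]//; rewrite mulr0.
Qed.

End RegularRepresentation.

Section CotlarProperty.
Variables (R : realType) (G : groupType).

Definition hankel (I : finType) (L : I -> set G) (eps : I -> R[i])
    (T : l2 R G -> l2 R G) : l2 R G -> l2 R G :=
  \sum_(i : I) eps i *: fourier_proj (L i) T.

Definition hankel_circ (I : finType) (L : I -> set G) (eps : I -> R[i])
    (T : l2 R G -> l2 R G) : l2 R G -> l2 R G :=
  \sum_(i : I)
    (eps i)^* *: fourier_proj [set g | exists2 h, L i h & g = h^-1%g] T.

Variables (X : Type) (d : X -> X -> R) (act : G -> X -> X) (o : X).

Definition L_exists (A : set X) : set G :=
  [set g | exists2 gamma, geodesic d o (act g o) gamma &
           meets d o (act g o) gamma A].

Definition L_forall (r : R) (A : set X) : set G :=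
  [set g | exists2 a, A a &
           forall gamma, geodesic d o (act g o) gamma ->
             meets d o (act g o) gamma (metric_ball d r a)].

Definition cotlar_at (rho : R) (m : nat) : Prop :=
  forall (I : finType) (A : I -> set X) (eps : I -> R[i]),
    (forall i, A i `<=` metric_sphere d o m) ->
    (forall i j, i != j ->
       L_forall rho (A i) `&` L_forall rho (A j) = set0) ->
    (forall i, `|eps i| <= 1) ->
    forall g h : G,
      (\bigcup_i L_exists (A i)) g -> (\bigcup_i L_exists (A i)) h ->
      2 * m%:R + 2 * rho <= d o (act (g * h^-1)%g o) ->
      let He := hankel (fun i => L_exists (A i)) eps in
      let He' := hankel_circ (fun i => L_exists (A i)) eps in
      let Ha := hankel (fun i => L_forall rho (A i)) eps in
      let Ha' := hankel_circ (fun i => L_forall rho (A i)) eps in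
      let lg : l2 R G -> l2 R G := lambda g in
      let lh' : l2 R G -> l2 R G := lambda h^-1%g in
      He lg \o He' lh' =
        Ha (lg \o Ha' lh') + Ha' (Ha lg \o lh') - Ha' (Ha (lg \o lh'))
      /\
      Ha (lg \o Ha' lh') + Ha' (Ha lg \o lh') - Ha' (Ha (lg \o lh')) =
        Ha (lg \o He' lh') + Ha' (He lg \o lh') - Ha' (Ha (lg \o lh')).

Definition cotlar (rho : R) : Prop := forall m : nat, cotlar_at rho m.

End CotlarProperty.

Section CayleyGraph.
Variables (R : realType) (G : groupType).

Definition finite_generating_set (S : set G) : Prop :=
  finite_set S /\
  forall H : {pred G}, group_closed H -> (forall s, S s -> s \in H) ->
    forall g, g \in H.

Definition finitely_generated : Prop :=
  exists S : set G, finite_generating_set S.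

Variable S : set G.

(* Edges are unoriented, without loops or multiplicity. *)
Definition adjacent (u v : G) : Prop :=
  u != v /\ exists2 s, S s & v = (u * s)%g \/ u = (v * s)%g.

(* Barycentric coordinates of the point at distance [t] from [u] on the
   segment [[u, v]]. *)
Definition bary (u v : G) (t : R) : G -> R :=
  fun w => (1 - t) * (w == u)%:R + t * (w == v)%:R.

Definition in_realization (x : G -> R) : Prop :=
  exists u v t, [/\ u = v \/ adjacent u v, 0 <= t <= 1 & x = bary u v t].

(* The geometric realization of the Cayley graph, in barycentric coordinates. *)
Definition cayley : Type := {x : G -> R | in_realization x}.

Lemma vertexP (g : G) : in_realization (bary g g 0).
Proof. by exists g, g, 0; split; [left|rewrite lexx ler01|]. Qed.

Definition vertex (g : G) : cayley := exist _ _ (vertexP g).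

Definition edge_segment (x y : cayley) (l : R) : Prop :=
  exists u v s t, [/\ adjacent u v, 0 <= s <= 1 /\ 0 <= t <= 1,
    sval x = bary u v s, sval y = bary u v t & l = `|s - t|].

Inductive edge_path : cayley -> cayley -> R -> Prop :=
| edge_path_nil x : edge_path x x 0
| edge_path_cons x y z l l' :
    edge_segment x y l -> edge_path y z l' -> edge_path x z (l + l').

(* The length metric with edges of length one. *)
Definition cayley_dist (x y : cayley) : R := inf [set l | edge_path x y l].

Lemma cayley_actP (g : G) (x : cayley) :
  in_realization (fun w => sval x (g^-1 * w)%g).
Proof.
case: x => x [u [v [t [uv t01 xE]]]] /=; exists (g * u)%g, (g * v)%g, t; split=> //.
  case: uv => [->|[uv [s Ss e]]]; [by left|right; split].
    by rewrite (inj_eq (mulgI g)).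
  by exists s => //; case: e => ->; rewrite mulgA; [left|right].
have sh w u' : (g^-1 * w == u')%g = (w == g * u')%g.
  by rewrite -(inj_eq (mulgI g)) mulVKg.
by apply/funext => w; rewrite xE /bary !sh.
Qed.

Definition cayley_act (g : G) (x : cayley) : cayley :=
  exist _ _ (cayley_actP g x).

Definition cayley_hyperbolic : Prop :=
  exists delta : R, delta_hyperbolic cayley_dist delta.

Definition cayley_cotlar_at (rho : R) (m : nat) : Prop :=
  cotlar_at cayley_dist cayley_act (vertex 1%g) rho m.

Definition cayley_cotlar (rho : R) : Prop :=
  cotlar cayley_dist cayley_act (vertex 1%g) rho.

End CayleyGraph.

Definition hyperbolic_group (R : realType) (G : groupType) : Prop :=
  exists2 S : set G, finite_generating_set S & cayley_hyperbolic R S.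

(* Main.v *)
Require Import Defs.
From mathcomp Require Import all_boot all_order all_algebra zify ring lra.
From mathcomp Require Import complex.
From mathcomp Require Import all_classical all_reals all_analysis.
Import Defs.

Set Implicit Arguments.
Unset Strict Implicit.
Unset Printing Implicit Defensive.

Import Order.TTheory GRing.Theory Num.Theory.

(** On the elements [lambda g] the Hankel operators act by scalars, so the
    Cotlar identity is an identity between the scalars attached to [g], [h] and
    [u = g h^-1].

    If the group is hyperbolic, thin triangles show that for [u] long either
    [u] lies in the same [L_forall] class as [g], or [u^-1] in the same class as
    [h]; the identity then reads [(b g - b u) (b h - b u^-1)^* = 0].

    Conversely, testing the identity on families of one or two points gives, for
    a triangle [p], [q], [r] whose side [pq] is longer than [2 m], that the point
    at distance [m] from [p] on [pr] is close to [pq], or the point at distance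
    [m] from [q] on [qr] is close to [pq].  For degenerate triangles this is a
    contraction: geodesics from [p] whose ends are at a distance small compared
    to [m] are within a constant independent of that distance at level [m].
    Sliding the vertex [x] of a triangle [p], [x], [y] along [xy] towards [y] by
    steps of length [mu], while the contraction resets the accumulated error,
    shows that [px] and [py] are close at level [mu] as soon as the Gromov
    product of [x] and [y] is a large multiple of [mu].  A single large [mu] is
    enough: from a point [a] of a geodesic [pq], the directions of [p] and [q]
    are separated, so [r] cannot have large Gromov product with both.

    Passing from one generating set to another uses the Morse lemma in terms of
    Gromov products. *)

(** * Intervals in integer-valued geodesic metrics *)

Section DiscreteGeodesicSpace.
Variables (V : Type) (d : V -> V -> nat).

Definition discrete_geodesic (n : nat) (v : nat -> V) : Prop :=
  forall i j, i <= j <= n -> d (v i) (v j) = j - i.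

Definition geodesic_metric : Prop :=
  [/\ forall x, d x x = 0, forall x y, d x y = d y x,
      forall x y z, d x z <= d x y + d y z &
      forall x y, exists v,
        [/\ v 0 = x, v (d x y) = y & discrete_geodesic (d x y) v]].

Definition between (x z y : V) : Prop := d x z + d z y = d x y.

Definition four_point (delta : nat) : Prop := forall x y z w,
  d x z + d y w <= maxn (d x y + d z w) (d x w + d y z) + delta.

(** Nearness to a side is measured by the excess [d a p + d a r - d p r], so that no point of that
    side has to be named. *)
Definition thin_intervals (delta : nat) : Prop := forall p q a r,
  between p a q ->
  d a p + d a r <= d p r + delta \/ d a q + d a r <= d q r + delta.

(* The geometric content of the [(rho, m)]-Cotlar property, [C >= 6 rho]. *)
Definition base_alternative (C m : nat) : Prop := forall p q r a c,
  2 * m + C <= d p q ->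
  between p a r -> d p a = m -> between q c r -> d q c = m ->
  (forall x, between p x q -> d p x = m -> d x a <= C) \/
  (forall y, between p y q -> d q y = m -> d y c <= C).

Hypothesis dP : geodesic_metric.

Lemma geo_refl x : d x x = 0. Proof. by case: dP. Qed.
Lemma geo_sym x y : d x y = d y x. Proof. by case: dP. Qed.
Lemma geo_triangle y x z : d x z <= d x y + d y z. Proof. by case: dP. Qed.

Lemma interval_level x y k : k <= d x y -> exists2 z, between x z y & d x z = k.
Proof.
move=> kd; case: dP => _ _ _ /(_ x y)[v [v0 vn vg]].
have := vg k (d x y); have := vg 0 k; rewrite v0 vn => h1 h2.
by exists (v k); rewrite /between ?h1 ?h2; lia.
Qed.

Lemma between_sym x z y : between x z y -> between y z x.
Proof. by rewrite /between (geo_sym y z) (geo_sym z x) (geo_sym y x); lia. Qed.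

Lemma between_trans p a w z : between p a w -> between p w z -> between p a z.
Proof.
rewrite /between => h1 h2.
by have := geo_triangle w a z; have := geo_triangle a p z; lia.
Qed.

Lemma between_extend p a z k : between p a z -> d p a <= k <= d p z ->
  exists w, [/\ between p a w, between p w z & d p w = k].
Proof.
move=> paz kd.
have [|w aw dw] := @interval_level a z (k - d p a).
  by move: paz; rewrite /between; lia.
exists w; move: paz aw; rewrite /between => paz aw.
have := geo_triangle a p w; have := geo_triangle w p z.
by split; lia.
Qed.

Lemma geodesic_through p a q : between p a q -> exists v,
  [/\ v 0 = p, v (d p a) = a, v (d p q) = q & discrete_geodesic (d p q) v].
Proof.
move=> paq; case: (dP) => _ _ _ ex.
have [v [v0 vn vg]] := ex p a; have [w [w0 wn wg]] := ex a q.
move: paq; rewrite /between => paq.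
exists (fun i => if i <= d p a then v i else w (i - d p a)); split => //=.
- by rewrite leqnn.
- case: leqP => h; last by rewrite -paq addKn.
  have aq0 : d a q = 0 by lia.
  by move: wn; rewrite -paq aq0 addn0 w0 vn.
move=> i j /andP[ij jn]; case: leqP => hi; case: leqP => hj.
- by rewrite vg; lia.
- have := vg i (d p a); have := vg 0 i; have := wg 0 (j - d p a).
  have := wg (j - d p a) (d a q); rewrite v0 vn w0 wn => h1 h2 h3 h4.
  have := geo_triangle a (v i) (w (j - d p a)).
  have := geo_triangle (v i) p q.
  have := geo_triangle (w (j - d p a)) (v i) q.
  by lia.
- lia.
- by rewrite wg; lia.
Qed.

Lemma four_point_thin delta : four_point delta -> thin_intervals delta.
Proof.
move=> H p q a r; rewrite /between => paq; have := H a p r q.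
by rewrite (geo_sym p a) (geo_sym r q) in paq *; lia.
Qed.

(** The inequality puts the level of [a] and [b] below the Gromov product of [x] and [y] at [w].
    Hence [a] has excess at most [delta] over the side [wy], and thinness at [b] on that side, with
    third vertex [a], costs another [delta]. *)
Lemma thin_insize delta w x y a b : thin_intervals delta ->
  between w a x -> between w b y -> d w a = d w b ->
  2 * d w a + d x y <= d w x + d w y -> d a b <= 2 * delta.
Proof.
move=> H wax wby ab le.
have ay : d a y + d w a <= d w y + delta.
  have := H _ _ _ y wax; move: wax wby; rewrite /between.
  by rewrite (geo_sym a w); lia.
have := H _ _ _ a wby; move: wax wby; rewrite /between.
by rewrite (geo_sym b w) (geo_sym b a) (geo_sym b y) (geo_sym y a); lia.
Qed.

(** At the level [t] of the smaller of two Gromov products, the points on [wx], [wy], [wz] are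
    successively [2 * delta] close, so [xz] can be joined through them. The summand [2] absorbs the
    rounding of the halves. *)
Lemma thin_four_point delta : thin_intervals delta -> four_point (4 * delta + 2).
Proof.
move=> H x y z w.
pose t := minn ((d w x + d w y - d x y) %/ 2) ((d w y + d w z - d y z) %/ 2).
have := geo_triangle w x y; have := geo_triangle w y z.
have := geo_triangle x w y; have := geo_triangle y w x.
have := geo_triangle y w z; have := geo_triangle z w y.
rewrite (geo_sym x w) (geo_sym y w) (geo_sym z w) (geo_sym y x) (geo_sym z y).
move=> h1 h2 h3 h4 h5 h6.
have [|a wa ta] := @interval_level w x t; first lia.
have [|b wb tb] := @interval_level w y t; first lia.
have [|c wc tc] := @interval_level w z t; first lia.
have ab : d a b <= 2 * delta by apply: (thin_insize H wa wb); lia.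
have bc : d b c <= 2 * delta by apply: (thin_insize H wb wc); lia.
have := geo_triangle b a c; have := geo_triangle a x c; have := geo_triangle c x z.
by move: wa wb wc; rewrite /between (geo_sym x a); lia.
Qed.

(** The alternative is applied to [p], [y] and a point [q] short of [z] on a geodesic through [a].
    Its first case is the claim; its second gives a shortcut from [p] to [y] that would make [d p y]
    less than [d p z - D]. *)
Lemma level_contraction C m D p z y a b : base_alternative C m ->
  d z y <= D -> 2 * D + C < 2 * m -> 3 * m + D + C <= d p z ->
  between p a z -> d p a = m -> between p b y -> d p b = m -> d a b <= C.
Proof.
move=> H zy Dm mz paz am pby bm.
(* The remaining distance [m + D] from [q] to [z] keeps [y] at distance at least [m] from [q]. *)
have [|q [paq pqz pq]] := @between_extend p a z (d p z - m - D) paz; first lia.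
have qz : d q z = m + D by move: pqz; rewrite /between; lia.
have := geo_triangle y q z; have := geo_triangle z q y; rewrite (geo_sym y z).
move=> t1 t2.
have [|c qcy qc] := @interval_level q y m; first lia.
have pqm : 2 * m + C <= d p q by lia.
have [|] := H p q y b c pqm pby bm qcy qc; first exact.
have [|e qep qe] := @interval_level q p m; first by rewrite geo_sym; lia.
move=> /(_ e (between_sym qep) qe) ec.
have := geo_triangle c p y; have := geo_triangle y p z; have := geo_triangle e p c.
by move: qep qcy; rewrite /between (geo_sym y z) (geo_sym e p) (geo_sym q p); lia.
Qed.

(** * Fellow travelling deduced from the alternative at a sequence of levels *)

Section Fellow.
Variables (C kappa : nat) (M : nat -> Prop).
Hypothesis M_alt : forall l, M l -> base_alternative C l.
Hypothesis M_gap : forall l, M l -> exists2 l', M l' & 5 * l <= l' <= kappa * l.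
Hypothesis M_unbounded : forall n, exists2 l, M l & n <= l.

(** If [B * l < d p z], then after a step of length [mu <= l] the distance to [p] is still at least
    [5 * kappa * l], hence at least five times any level up to [kappa * l]. *)
Let B := 5 * kappa + 1.

Section Descent.
Variables (mu : nat) (p x y : V).
Hypothesis (Mmu : M mu) (mu_large : 5 * C + 4 * C * B * kappa < mu).
Hypothesis xy_far : 2 * (5 * kappa * mu) + d x y <= d p x + d p y.

(* The allowed error at level [l] is [C] as long as [B * l <= d p z], and then
   grows by at most [C] for each step of length [mu] towards [p]: it remains
   small compared to [l], so that it can be contracted at a lower level. *)
Let tracks (z : V) : Prop := forall l a a', M l -> mu <= l -> 5 * l <= d p z ->
  between p a x -> d p a = l -> between p a' z -> d p a' = l ->
  mu * d a a' <= mu * C + 2 * C * (B * l - d p z).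

Let kappa_ge5 : 5 <= kappa.
Proof. by have [l' _] := M_gap Mmu; nia. Qed.

(** The error allowed at a level up to [kappa * l], after one more step, meets the smallness
    condition of [level_contraction] at level [l]. *)
Let mu_lt l e : mu <= l -> mu * e <= 2 * C * mu + 2 * C * (B * (kappa * l)) ->
  2 * e + C < 2 * l.
Proof.
move=> ml h; have {}h : mu * (2 * e + C) < mu * (2 * l).
  have : (5 * C + 4 * C * B * kappa + 1) * l <= mu * l by rewrite leq_mul2r; lia.
  have : 5 * C * mu <= 5 * C * l by rewrite leq_mul2l ml orbT.
  by nia.
by rewrite ltn_mul2l in h; case/andP: h.
Qed.

Let gt_C : 5 * C < mu. Proof. lia. Qed.

Lemma tracks_start : tracks x.
Proof.
move=> l a a' Ml ml lx pa al pa' al'.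
have : d a a' <= C.
  by apply: (level_contraction (M_alt Ml) (D := 0) (z := x) (y := x) (p := p));
     rewrite ?geo_refl//; lia.
by move=> h; rewrite (leq_trans _ (leq_addr _ _))// leq_mul2l h orbT.
Qed.

(** The hypothesis on [w] is the second case of the alternative: moving from [z] to [c] is almost
    moving back towards [p]. Geodesics to [c] are compared with geodesics to [w0], which extend to
    [z], where the previous bound applies. *)
Lemma tracks_step z c : tracks z -> d p z <= d p x -> 2 * mu + C <= d p z ->
  d z c = mu ->
  (forall w, between p w z -> d z w = mu -> d w c <= C) ->
  tracks c /\ d p c <= d p z.
Proof.
move=> Hz zx muz zc Hw.
have [|w0 pw0 zw0] := @interval_level z p mu; first by rewrite geo_sym; lia.
have := Hw w0 (between_sym pw0) zw0 => w0c.
have pc1 : d p c + mu <= d p z + C.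
  have := geo_triangle w0 p c; move: pw0; rewrite /between.
  by rewrite (geo_sym w0 p) (geo_sym z p); lia.
have pc2 : d p z <= d p c + mu.
  by have := geo_triangle c p z; rewrite (geo_sym c z); lia.
have near l a' a'' : M l -> mu <= l -> 5 * l <= d p c ->
    between p a' w0 -> d p a' = l -> between p a'' c -> d p a'' = l ->
    d a' a'' <= C.
  move=> Ml ml lc pa' al' pa'' al''.
  apply: (level_contraction (M_alt Ml) (D := C) (z := w0) (y := c) (p := p)) => //.
    by lia.
  by have := geo_triangle w0 p c; lia.
have step l a a'' : M l -> mu <= l -> 5 * l <= d p c ->
    between p a x -> d p a = l -> between p a'' c -> d p a'' = l ->
    mu * d a a'' <= 2 * C * mu + 2 * C * (B * l - d p z).
  move=> Ml ml lc pa al pa'' al''.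
  have [|a' pa' al'] := @interval_level p w0 l.
    by have := geo_triangle w0 p c; lia.
  have a'a'' := near _ _ _ Ml ml lc pa' al' pa'' al''.
  have := Hz l a a' Ml ml _ pa al (between_trans pa' (between_sym pw0)) al'.
  move=> /(_ ltac:(lia)) h1.
  have : mu * d a a'' <= mu * (d a a' + d a' a'').
    by rewrite leq_mul2l geo_triangle orbT.
  have : mu * d a' a'' <= mu * C by rewrite leq_mul2l a'a'' orbT.
  by rewrite mulnDr; lia.
split; last lia.
move=> l a a'' Ml ml lc pa al pa'' al''.
(* Here [d p c] drops by at least [mu - C], so the allowed error grows by at least [C * mu], which
   pays for the step. *)
have [zB|Bz] := leqP (d p z) (B * l).
  have := step _ _ _ Ml ml lc pa al pa'' al''.
  have : C * mu <= 2 * C * (d p z - d p c) by nia.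
  by rewrite !mulnBr; nia.
(* Otherwise the geodesics are compared at a higher level [l1], and contraction down to level [l]
   resets the error to [C]. *)
have [l1 Ml1 /andP[l1a l1b]] := M_gap Ml.
have l1c : 5 * l1 <= d p c by rewrite /B in Bz; nia.
have [|a1 [pa1 pa1x a1l]] := @between_extend p a x l1 pa; first lia.
have [|a2 [pa2 pa2c a2l]] := @between_extend p a'' c l1 pa''; first lia.
have h := step _ _ _ Ml1 ltac:(lia) l1c pa1x a1l pa2c a2l.
have e : 2 * d a1 a2 + C < 2 * l.
  apply: mu_lt => //; apply: leq_trans h _; rewrite leq_add2l leq_mul2l.
  apply/orP; right; apply: leq_trans (leq_subr _ _) _.
  by rewrite leq_mul2l l1b orbT.
have : d a a'' <= C.
  by apply: (level_contraction (M_alt Ml) (D := d a1 a2) (z := a1)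
    (y := a2) (p := p)) => //; lia.
by move=> k; rewrite (leq_trans _ (leq_addr _ _))// leq_mul2l k orbT.
Qed.

Let far_left z : between x z y -> 5 * kappa * mu <= d p z.
Proof.
have := geo_triangle z p y; have := geo_triangle z p x.
by rewrite /between (geo_sym z x); lia.
Qed.

Let far_right : 5 * kappa * mu <= d p y.
Proof. by have := geo_triangle y p x; rewrite (geo_sym y x); lia. Qed.

Let kappa_mu : 5 * mu <= kappa * mu.
Proof. by rewrite leq_mul2r kappa_ge5 orbT. Qed.

(** A remaining distance below [mu] is handled by a contraction at a level [l1], followed by one
    from [l1] down to [mu]. *)
Lemma descent_end z a b : d z y < mu -> tracks z -> between x z y ->
  d p z <= d p x ->
  between p a x -> d p a = mu -> between p b y -> d p b = mu -> d a b <= C.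
Proof.
move=> zymu Hz xzy zx pa al pb bl; have := far_left xzy; have := far_right.
rewrite -mulnA => py pz.
have [l1 Ml1 /andP[l1a l1b]] := M_gap Mmu.
have [|a1 [pa1 pa1x a1l]] := @between_extend p a x l1 pa; first lia.
have [|b1 [pb1 pb1y b1l]] := @between_extend p b y l1 pb; first lia.
have [|a' pa' al'] := @interval_level p z l1; first lia.
have h1 : d a' b1 <= C.
  by apply: (level_contraction (M_alt Ml1) (D := mu) (z := z) (y := y) (p := p));
     rewrite //; lia.
have h2 := Hz l1 a1 a' Ml1 ltac:(lia) ltac:(lia) pa1x a1l pa' al'.
have h3 : mu * d a1 b1 <= 2 * C * mu + 2 * C * (B * (kappa * mu)).
  have : mu * d a1 b1 <= mu * (d a1 a' + d a' b1).
    by rewrite leq_mul2l geo_triangle orbT.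
  have : mu * d a' b1 <= mu * C by rewrite leq_mul2l h1 orbT.
  have : 2 * C * (B * l1 - d p z) <= 2 * C * (B * (kappa * mu)).
    rewrite leq_mul2l; apply/orP; right; apply: leq_trans (leq_subr _ _) _.
    by rewrite leq_mul2l l1b orbT.
  by rewrite mulnDr; lia.
have h4 := mu_lt (leqnn _) h3.
by apply: (level_contraction (M_alt Mmu) (D := d a1 b1) (z := a1) (y := b1)
    (p := p)); rewrite //; lia.
Qed.

(** The alternative for [p], [z], [y] at level [mu] decides each round: its first case compares [b]
    with the geodesic to [z] and stops, its second moves [z] on to [c]. *)
Lemma descent n z a b : d z y <= n -> tracks z -> between x z y ->
  d p z <= d p x ->
  between p a x -> d p a = mu -> between p b y -> d p b = mu ->
  d a b <= C * (2 + 2 * B).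
Proof.
elim: n z => [|n IH] z zyn Hz xzy zx pa al pb bl.
  apply: leq_trans (descent_end _ Hz xzy zx pa al pb bl) _; first lia.
  by rewrite leq_pmulr.
have [muzy|zymu] := leqP mu (d z y); last first.
  apply: leq_trans (descent_end zymu Hz xzy zx pa al pb bl) _.
  by rewrite leq_pmulr.
have [c zcy zc] := interval_level muzy.
have := far_left xzy; have := far_right; rewrite -mulnA => py pz.
have muz : 2 * mu + C <= d p z by lia.
have [H|H] := M_alt Mmu muz pb bl zcy zc.
  have [|a' pa' al'] := @interval_level p z mu; first lia.
  have a'b := H a' pa' al'.
  have h := Hz mu a a' Mmu (leqnn _) ltac:(lia) pa al pa' al'.
  have bd : 2 * C * (B * mu - d p z) <= 2 * C * (B * mu).
    by rewrite leq_mul2l leq_subr orbT.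
  have {}h : mu * d a a' <= mu * (C + 2 * C * B) by rewrite mulnDr; lia.
  by rewrite leq_mul2l in h; have := geo_triangle a' a b; lia.
have [tc cz] := tracks_step Hz zx ltac:(lia) zc H.
apply: (IH c) => //; last by lia.
  by move: zcy; rewrite /between; lia.
by apply: between_sym; apply: between_trans (between_sym zcy) (between_sym xzy).
Qed.

Lemma fellow_travel a b :
  between p a x -> d p a = mu -> between p b y -> d p b = mu ->
  d a b <= C * (2 + 2 * B).
Proof.
move=> pa al pb bl; apply: (descent (leqnn _) tracks_start) => //.
by rewrite /between geo_refl.
Qed.

End Descent.
Lemma base_alternative_thin : exists delta, thin_intervals delta.
Proof.
have [mu Mmu mu_ge] :=
  M_unbounded (C * (2 + 2 * B) + 5 * C + 4 * C * B * kappa + 1).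
have mu_large : 5 * C + 4 * C * B * kappa < mu by lia.
(* With this constant, the failure of both cases gives [xy_far] at the base point [a], for [p] and
   [r] as well as for [q] and [r]. *)
exists (2 * (5 * kappa * mu)) => p q a r paq; apply: contrapT => /not_orP[].
move=> /negP; rewrite -ltnNge => hp /negP; rewrite -ltnNge => hq.
have kmu : 5 * mu <= kappa * mu.
  by have [l' _ /andP[]] := M_gap Mmu; exact: leq_trans.
have := geo_triangle a p r; have := geo_triangle a q r.
have := geo_triangle p a r; have := geo_triangle q a r.
have := geo_triangle r a p; rewrite (geo_sym r p).
rewrite (geo_sym p a) (geo_sym q a) => h0 h1 h2 h3 h4.
have [|p1 ap1 p1l] := @interval_level a p mu; first lia.
have [|q1 aq1 q1l] := @interval_level a q mu; first lia.
have [|r1 ar1 r1l] := @interval_level a r mu; first lia.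
have pr : d p1 r1 <= C * (2 + 2 * B).
  by apply: (fellow_travel Mmu mu_large _ ap1 p1l ar1 r1l); lia.
have qr : d q1 r1 <= C * (2 + 2 * B).
  by apply: (fellow_travel Mmu mu_large _ aq1 q1l ar1 r1l); lia.
have := geo_triangle p1 p q; have := geo_triangle q1 p1 q.
have := geo_triangle r1 p1 q1.
(* As [a] lies between [p] and [q], the points [p1] and [q1] are at distance [2 * mu], too much for
   both to be close to [r1]. *)
move: paq ap1 aq1; rewrite /between (geo_sym r1 q1) (geo_sym p1 p) (geo_sym p a).
by lia.
Qed.

End Fellow.
End DiscreteGeodesicSpace.

(** * Invariance of hyperbolicity under quasi-isometries *)

Lemma linear_le_exp A B : exists k0, forall k, k0 <= k -> A * k + B <= 2 ^ k.
Proof.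
have step k : A <= 2 ^ k -> A * k + B <= 2 ^ k ->
    forall j, A * (k + j) + B <= 2 ^ (k + j).
  move=> h1 h2; elim=> [|j IH]; first by rewrite addn0.
  have : 2 ^ k <= 2 ^ (k + j) by rewrite leq_exp2l// leq_addr.
  by rewrite addnS expnS; nia.
pose n := 2 * A + B.
have sq : n.+1 * n.+1 <= 2 ^ (2 * n).
  have := ltn_expl n (ltnSn 1).
  by rewrite mul2n -addnn expnD => h; apply: leq_mul.
exists (2 * n) => k nk; rewrite -(subnKC nk); apply: step.
  by apply: leq_trans sq; rewrite /n; nia.
by apply: leq_trans sq; rewrite /n; nia.
Qed.

Section QuasiIsometry.
Variables (V : Type) (d d' : V -> V -> nat) (lam delta : nat).
Hypotheses (dP : geodesic_metric d) (d'P : geodesic_metric d').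
Hypotheses (dd' : forall x y, d x y <= lam * d' x y).
Hypotheses (d'd : forall x y, d' x y <= lam * d x y).
Hypothesis dH : four_point d delta.

(* Twice the Gromov product based at [w]. *)
Let gromov w x y : nat := d w x + d w y - d x y.

Let gromov_min w x y z :
  minn (gromov w x y) (gromov w y z) <= gromov w x z + delta.
Proof.
have := dH x y z w; rewrite /gromov.
have := geo_triangle dP w x y; have := geo_triangle dP w y z.
have := geo_triangle dP w x z.
by rewrite (geo_sym dP x w) (geo_sym dP y w) (geo_sym dP z w); lia.
Qed.

(** Cutting the chain in half [k] times loses one [delta] each time. The bound on [2 * d w (v i)]
    covers the chain without edges. *)
Let gromov_chain k g w (v : nat -> V) i n : n <= 2 ^ k -> g <= 2 * d w (v i) ->
  (forall j, i <= j < i + n -> g <= gromov w (v j) (v j.+1)) ->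
  g <= gromov w (v i) (v (i + n)) + k * delta.
Proof.
elim: k i n => [|k IH] i n nk g0 H.
  case: n nk H => [|[|n]]; rewrite ?expn0 => // _ H.
    by rewrite addn0 /gromov (geo_refl dP); lia.
  by rewrite addn1 (leq_trans (H i _)) ?leq_addr//; lia.
have [nk'|kn] := leqP n (2 ^ k).
  by have := IH _ _ nk' g0 H; rewrite mulSn; lia.
have h1 : g <= gromov w (v i) (v (i + 2 ^ k)) + k * delta.
  by apply: IH => // j ij; apply: H; lia.
have g1 : g <= 2 * d w (v (i + 2 ^ k)).
  have := H (i + 2 ^ k) ltac:(lia); rewrite /gromov.
  by have := geo_triangle dP (v (i + 2 ^ k)) w (v (i + 2 ^ k).+1); lia.
have := IH (i + 2 ^ k) (n - 2 ^ k) ltac:(rewrite expnS in nk; lia) g1.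
have -> : i + 2 ^ k + (n - 2 ^ k) = i + n by lia.
move=> h2; have {}h2 := h2 (fun j hj => H j ltac:(lia)).
by have := gromov_min w (v i) (v (i + 2 ^ k)) (v (i + n)); rewrite mulSn; lia.
Qed.

(** Morse lemma. Let [w] be a point of the geodesic at maximal distance [D] from [c]. Points on
    either side of [w] are joined through a piece of [c] of length linear in [D] that stays [D] away
    from [w]. The Gromov product along it is [2 * D] up to a logarithmic loss, whereas the two side
    points have product zero. *)
Lemma geodesic_near_quasigeodesic : exists D0, forall p q c x,
  c 0 = p -> c (d' p q) = q -> discrete_geodesic d' (d' p q) c ->
  between d p x q -> exists2 i, i <= d' p q & d x (c i) <= D0.
Proof.
have [k0 Hk0] := linear_le_exp (6 * lam * lam * delta.+1)
  (6 * lam * lam * delta.+1).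
exists (k0 * delta.+1 + lam + 2 * delta) => p q c x c0 cn cg pxq.
set n := d' p q in cn cg *.
have [v [v0 vx vN vg]] := geodesic_through dP pxq.
set N := d p q in vN vg.
have xN : d p x <= N by move: pxq; rewrite /between; lia.
pose far D := `[< exists2 t, t <= N & forall i, i <= n -> D <= d (v t) (c i) >].
have far0 : exists D, far D.
  by exists 0; apply/asboolP; exists 0.
have far_le D : far D -> D <= N.
  move/asboolP => [t tN /(_ 0 isT)]; rewrite c0 -v0 (geo_sym dP) vg; lia.
case: (ex_maxnP far0 far_le) => D /asboolP[t tN farD] maxD.
have near s : s <= N -> exists2 i, i <= n & d (v s) (c i) <= D.
  move=> sN; apply: contrapT => H.
  suff : D.+1 <= D by rewrite ltnn.
  apply: maxD; apply/asboolP; exists s => // i i_n.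
  by rewrite ltnNge; apply/negP => h; apply: H; exists i.
suff D_le : D <= k0 * delta.+1 + lam + 2 * delta.
  have [i i_n h] := near _ xN; exists i => //.
  by rewrite -vx; apply: leq_trans h D_le.
set w := v t in farD.
(* The point [y] is [2 * D] before [w], or the end [p] if that is nearer; [z] is chosen in the same
   way after [w]. *)
have [y [i [ay i_n yt yi gy]]] : exists y i, [/\ exists2 s, s <= t & y = v s,
    i <= n, d w y <= 2 * D, d y (c i) <= D & 2 * D <= gromov w y (c i)].
  have [Dt|tD] := leqP (2 * D) t.
    have [i i_n h] := near (t - 2 * D) ltac:(lia).
    exists (v (t - 2 * D)), i; have := vg (t - 2 * D) t; have := farD i i_n.
    rewrite /gromov (geo_sym dP (v (t - _))) -/w => h1 h2.
    split => //; [by exists (t - 2 * D) => //; lia| lia|].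
    by have := geo_sym dP (v (t - 2 * D)) w; lia.
  exists p, 0; rewrite c0 /gromov (geo_refl dP); have := farD 0 isT.
  have := vg 0 t; rewrite v0 -/w (geo_sym dP p) c0.
  by split => //; [exists 0|lia|lia].
have [z [k [az k_n zt zk gz]]] : exists z k, [/\ exists2 s, t <= s <= N & z = v s,
    k <= n, d w z <= 2 * D, d z (c k) <= D & 2 * D <= gromov w z (c k)].
  have [DN|ND] := leqP (t + 2 * D) N.
    have [k k_n h] := near (t + 2 * D) DN.
    exists (v (t + 2 * D)), k; have := vg t (t + 2 * D); have := farD k k_n.
    rewrite /gromov -/w => h1 h2.
    by split => //; [by exists (t + 2 * D) => //; lia| lia| lia].
  exists q, n; rewrite cn /gromov (geo_refl dP); have := farD n (leqnn _).
  have := vg t N; rewrite vN -/w cn.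
  by split => //; [exists N => //; lia|lia|lia].
have yz : gromov w y z = 0.
  case: ay az => s st -> [s' /andP[ts' s'N] ->]; rewrite /gromov /w.
  by rewrite (geo_sym dP (v t) (v s)) !vg; lia.
(* The [d]-distance from [c i] to [c k] is at most [D + 2 * D + 2 * D + D], through [y], [w] and
   [z]. *)
have ik : maxn i k - minn i k <= lam * (6 * D).
  have : d' (c (minn i k)) (c (maxn i k)) <= lam * d (c i) (c k).
    have [h|h] := leqP i k; first exact: d'd.
    by rewrite (geo_sym dP (c i)); apply: d'd.
  rewrite cg ?geq_max; last by lia.
  move=> h; apply: leq_trans h _; rewrite leq_mul2l; apply/orP; right.
  have := geo_triangle dP y (c i) (c k); have := geo_triangle dP w y (c k).
  have := geo_triangle dP z w (c k).
  by rewrite (geo_sym dP (c i) y) (geo_sym dP y w); lia.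
have chain e : maxn i k - minn i k <= 2 ^ e ->
    2 * D - lam <= gromov w (c i) (c k) + e * delta.
  move=> h.
  have := @gromov_chain e (2 * D - lam) w c (minn i k) _ h.
  have -> : minn i k + (maxn i k - minn i k) = maxn i k by lia.
  have -> : gromov w (c (minn i k)) (c (maxn i k)) = gromov w (c i) (c k).
    by have [?|?] := leqP i k => //; rewrite /gromov addnC (geo_sym dP (c k)).
  apply; first by have := farD (minn i k) ltac:(lia); lia.
  move=> j hj; have := farD j ltac:(lia); have := farD j.+1 ltac:(lia).
  have := dd' (c j) (c j.+1); rewrite cg; last lia.
  by rewrite subSnn muln1 /gromov; lia.
have main e : maxn i k - minn i k <= 2 ^ e -> 2 * D - lam <= e.+2 * delta.
  move=> /chain h; have := gromov_min w y (c i) (c k).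
  have := gromov_min w y (c k) z; rewrite yz.
  have -> : gromov w (c k) z = gromov w z (c k).
    by rewrite /gromov addnC (geo_sym dP z).
  by rewrite !mulSn; lia.
rewrite leqNgt; apply/negP => big.
(* This [e] satisfies [e * delta <= D], and [2 ^ e] exceeds the length of the piece of [c] as soon
   as [k0 <= e]. *)
pose e := D %/ delta.+1.
have eD : e * delta.+1 <= D by exact: leq_trunc_div.
have De : D < e.+1 * delta.+1 by rewrite ltn_ceil.
have k0e : k0 <= e by rewrite /e leq_divRL//; lia.
have : 2 * D - lam <= e.+2 * delta.
  apply: main; apply: leq_trans ik _; apply: leq_trans (Hk0 _ k0e).
  have : lam * (6 * D) <= lam * (6 * (e.+1 * delta.+1)).
    by rewrite !leq_mul2l (ltnW De) !orbT.
  case: (lam) => [|l]; first by rewrite !mul0n.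
  by nia.
by rewrite !mulSn; rewrite mulnS in eD; lia.
Qed.

(** A connectedness argument: along the [d]-geodesic, the indices of nearby points of [c] pass from
    at most [j] to at least [j]. At the switch, two indices enclosing [j] belong to points at
    [d]-distance at most [2 * D0 + 1], so [c j] is close to them. *)
Lemma quasigeodesic_near_geodesic : exists E, forall p a q, between d' p a q ->
  exists2 x, between d p x q & d a x <= E.
Proof.
have [D0 HD0] := geodesic_near_quasigeodesic.
exists (lam * (lam * (2 * D0 + 1)) + D0) => p a q paq.
have [c [c0 ca cn cg]] := geodesic_through d'P paq.
case: (dP) => _ _ _ /(_ p q)[v [v0 vN vg]].
set N := d p q in vN vg; set n := d' p q in cn cg; set j := d' p a in ca.
have jn : j <= n by move: paq; rewrite /between -/j -/n; lia.
have onv t : t <= N -> between d p (v t) q.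
  move=> tN; have := vg 0 t; have := vg t N; rewrite v0 vN /between.
  by rewrite /N in tN *; lia.
pose left_near t := `[< exists2 i, i <= j & d (v t) (c i) <= D0 >].
pose right_near t := `[< exists2 i, j <= i <= n & d (v t) (c i) <= D0 >].
have near t : t <= N -> left_near t || right_near t.
  move=> tN; have [i i_n h] := HD0 p q c (v t) c0 cn cg (onv t tN).
  have [ij|ji] := leqP i j; apply/orP; [left|right]; apply/asboolP.
    by exists i.
  by exists i => //; rewrite i_n (ltnW ji).
have [t tN [/asboolP[i ij hi] [t' [t'N tt' /asboolP[k /andP[jk kn] hk]]]]] :
    exists2 t, t <= N & left_near t /\
      exists t', [/\ t' <= N, d (v t) (v t') <= 1 & right_near t'].
  have rN : exists t, (t <= N) && right_near t.
    exists N; rewrite leqnn; apply/asboolP; exists n.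
      by rewrite jn leqnn.
    by rewrite vN cn (geo_refl dP).
  case: (ex_minnP rN) => -[|t] /andP[tN rt] tmin.
    exists 0 => //; split; last by exists 0; rewrite (geo_refl dP).
    by apply/asboolP; exists 0 => //; rewrite v0 c0 (geo_refl dP).
  exists t; first lia; split; last first.
    by exists t.+1; split => //; rewrite vg; lia.
  have /orP[//|r] := near t ltac:(lia).
  by have := tmin t; rewrite r (ltnW tN) ltnn => /(_ isT).
exists (v t); first exact: onv.
have ik : k - i <= lam * (2 * D0 + 1).
  have := d'd (c i) (c k); rewrite cg ?(leq_trans ij jk) //.
  move=> h; apply: leq_trans h _; rewrite leq_mul2l; apply/orP; right.
  have := geo_triangle dP (v t) (c i) (c k).
  have := geo_triangle dP (v t') (v t) (c k).
  by rewrite (geo_sym dP (c i) (v t)); lia.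
have := geo_triangle dP (c i) a (v t); have := dd' (c i) (c j).
rewrite cg ?ij // ca (geo_sym dP (c i) a) (geo_sym dP (c i) (v t)).
have : lam * (j - i) <= lam * (lam * (2 * D0 + 1)) by rewrite leq_mul2l; lia.
by lia.
Qed.

(** A point of a [d']-geodesic is replaced by a nearby point of a [d]-geodesic, thinness is used
    there, and the Morse lemma leads back to a [d']-geodesic on the other side. *)
Lemma quasi_isometry_thin : exists delta', thin_intervals d' delta'.
Proof.
have [D0 HD0] := geodesic_near_quasigeodesic.
have [E HE] := quasigeodesic_near_geodesic.
have side p a x r : d a x <= E -> d x p + d x r <= d p r + delta ->
    d' a p + d' a r <= d' p r + 2 * (lam * (E + 2 * delta + D0)).
  move=> ax xpr.
  have [|y pyr yp] := @interval_level _ _ dP p r (minn (d p x) (d p r)); first lia.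
  have xy : d x y <= 2 * delta.
    have := dH x p y r; move: pyr; rewrite /between.
    by rewrite (geo_sym dP p x) in yp; lia.
  case: (d'P) => _ _ _ /(_ p r)[c [c0 cn cg]].
  have [i i_n yc] := HD0 p r c y c0 cn cg pyr.
  have ac : d' a (c i) <= lam * (E + 2 * delta + D0).
    apply: leq_trans (d'd _ _) _; rewrite leq_mul2l; apply/orP; right.
    by have := geo_triangle dP x a (c i); have := geo_triangle dP y x (c i); lia.
  have := cg 0 i; have := cg i (d' p r); rewrite c0 cn.
  have := geo_triangle d'P (c i) a p; have := geo_triangle d'P (c i) a r.
  by rewrite (geo_sym d'P (c i) p); lia.
exists (2 * (lam * (E + 2 * delta + D0))) => p q a r paq.
have [x pxq ax] := HE p a q paq.
by have [h|h] := four_point_thin dP dH r pxq; [left|right]; apply: side ax h.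
Qed.

End QuasiIsometry.

(** * Word metrics *)

Local Open Scope classical_set_scope.

Section WordMetric.
Variables (G : groupType) (S : set G).

Definition walk (n : nat) (u v : G) : Prop := exists w : nat -> G,
  [/\ w 0 = u, w n = v &
      forall i, i < n -> w i = w i.+1 \/ adjacent S (w i) (w i.+1)].

(** The value 0 is the default when no walk exists, a case excluded by [walk_exists] for a
    generating set. *)
Definition word_dist (u v : G) : nat :=
  if pselect (exists n, `[< walk n u v >]) is left e then ex_minn e else 0.

Lemma adjacent_sym u v : adjacent S u v -> adjacent S v u.
Proof.
by move=> [uv [s Ss e]]; split; [rewrite eq_sym|exists s => //; case: e; auto].
Qed.

Lemma adjacent_translate g u v : adjacent S u v -> adjacent S (g * u)%g (g * v)%g.
Proof.
move=> [uv [s Ss e]]; split; first by rewrite (inj_eq (mulgI g)).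
by exists s => //; case: e => ->; rewrite mulgA; auto.
Qed.

Lemma walk_refl u : walk 0 u u. Proof. by exists (fun=> u). Qed.

Lemma walk1 u v : adjacent S u v -> walk 1 u v.
Proof.
by move=> uv; exists (fun i => if i is 0 then u else v); split => // -[|//]; right.
Qed.

Lemma walk_cat m n u v z : walk m u v -> walk n v z -> walk (m + n) u z.
Proof.
move=> [w [w0 wm ws]] [w' [w'0 w'n w's]].
exists (fun i => if i <= m then w i else w' (i - m)); split => //=.
- case: leqP => [h|_]; last by rewrite addKn.
  have n0 : n = 0 by lia.
  by rewrite n0 addn0 wm -w'0 -w'n n0.
move=> i imn; have [im|mi|im] := ltngtP i m; last 1 first.
- by rewrite im subSnn wm -w'0; apply: w's; lia.
- exact: ws.
- by rewrite subSn ?(ltnW mi)//; apply: w's; lia.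
Qed.

Lemma walk_sym n u v : walk n u v -> walk n v u.
Proof.
move=> [w [w0 wn ws]]; exists (fun i => w (n - i)).
rewrite subn0 subnn; split => // i i_n.
have := ws (n - i.+1) ltac:(lia); have -> : (n - i.+1).+1 = n - i by lia.
by case=> [->|/adjacent_sym]; auto.
Qed.

Lemma walk_translate g n u v : walk n u v -> walk n (g * u)%g (g * v)%g.
Proof.
move=> [w [<- <- ws]]; exists (fun i => g * w i)%g; split => // i /ws[->|h]; auto.
by right; exact: adjacent_translate.
Qed.

Hypothesis genS : finite_generating_set S.

(** The elements joined to the identity form a subgroup containing [S], since walks can be
    translated, reversed and concatenated. *)
Lemma walk_exists u v : exists n, walk n u v.
Proof.
have [_ gen] := genS.
pose H : {pred G} := fun g => `[< exists n, walk n 1%g g >].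
suff : (u^-1 * v)%g \in H.
  move/asboolP => [n /(walk_translate u)]; rewrite mulg1 mulVKg.
  by exists n.
apply: gen => [|s Ss].
  split; first by apply/asboolP; exists 0; exact: walk_refl.
  move=> g h /asboolP[m gm] /asboolP[n hn]; apply/asboolP; exists (m + n).
  apply: walk_cat gm _; have := walk_translate (g * h^-1)%g (walk_sym hn).
  by rewrite -mulgA mulVg !mulg1.
apply/asboolP; have [<-|s1] := eqVneq 1%g s; first by exists 0; exact: walk_refl.
by exists 1; apply: walk1; split => //; exists s => //; left; rewrite mul1g.
Qed.

Lemma word_dist_walk u v : walk (word_dist u v) u v.
Proof.
rewrite /word_dist; case: pselect => [e|[]]; first by case: ex_minnP => n /asboolP.
by have [n h] := walk_exists u v; exists n; exact/asboolP.
Qed.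

Lemma word_dist_le n u v : walk n u v -> word_dist u v <= n.
Proof.
rewrite /word_dist => h; case: pselect => [e|//].
by case: ex_minnP => k _ /(_ n); apply; exact/asboolP.
Qed.

Lemma word_distxx u : word_dist u u = 0.
Proof. by apply/eqP; rewrite -leqn0; exact/word_dist_le/walk_refl. Qed.

Lemma word_dist_sym u v : word_dist u v = word_dist v u.
Proof.
by apply/eqP; rewrite eqn_leq !word_dist_le//; exact/walk_sym/word_dist_walk.
Qed.

Lemma word_dist_triangle v u z : word_dist u z <= word_dist u v + word_dist v z.
Proof. by apply/word_dist_le/(@walk_cat _ _ _ v); exact: word_dist_walk. Qed.

Lemma word_dist_translate g u v : word_dist (g * u)%g (g * v)%g = word_dist u v.
Proof.
apply/eqP; rewrite eqn_leq !word_dist_le//.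
  by rewrite -{2}(mulKg g u) -{2}(mulKg g v); exact/walk_translate/word_dist_walk.
exact/walk_translate/word_dist_walk.
Qed.

Lemma word_dist_adjacent u v : adjacent S u v -> word_dist u v <= 1.
Proof. by move=> /walk1 /word_dist_le. Qed.

Lemma subwalk_le (w : nat -> G) n i j :
  (forall k, k < n -> w k = w k.+1 \/ adjacent S (w k) (w k.+1)) ->
  i <= j <= n -> word_dist (w i) (w j) <= j - i.
Proof.
move=> ws ijn; apply: word_dist_le; exists (fun k => w (i + k)).
rewrite addn0 subnKC; last by lia.
by split => // k kj; rewrite addnS; apply: ws; lia.
Qed.

(** In a shortest walk the bounds on subwalks add up to the total length, so they are all
    equalities; in particular the walk never pauses. *)
Lemma word_dist_geodesic_steps n u v : word_dist u v = n -> exists w : nat -> G,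
  [/\ w 0 = u, w n = v, discrete_geodesic word_dist n w &
      forall i, i < n -> adjacent S (w i) (w i.+1)].
Proof.
move=> <-; have [w [w0 wn ws]] := word_dist_walk u v; exists w.
have g : discrete_geodesic word_dist (word_dist u v) w.
  move=> i j ijn; have := subwalk_le ws ijn.
  have := @subwalk_le _ _ 0 i ws ltac:(lia).
  have := @subwalk_le _ _ j (word_dist u v) ws ltac:(lia).
  have := word_dist_triangle (w i) u v; have := word_dist_triangle (w j) (w i) v.
  by rewrite w0 wn; lia.
split => // i i_n; case: (ws i i_n) => // e.
by have := g i i.+1; rewrite -e word_distxx; lia.
Qed.

Lemma word_dist_geodesic : geodesic_metric word_dist.
Proof.
split; [exact: word_distxx|exact: word_dist_sym| |].
  by move=> x y z; exact: word_dist_triangle.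
move=> x y.
by have [w [? ? ? _]] := word_dist_geodesic_steps (erefl (word_dist x y)); exists w.
Qed.

End WordMetric.

Lemma geodesic_adjacent (G : groupType) (S : set G) n (w : nat -> G) i :
  finite_generating_set S -> discrete_geodesic (word_dist S) n w -> i < n ->
  adjacent S (w i) (w i.+1).
Proof.
move=> genS wg i_n; have d1 : word_dist S (w i) (w i.+1) = 1 by rewrite wg; lia.
have [v [<- <- _ vs]] := word_dist_geodesic_steps genS d1.
by have := vs 0 isT.
Qed.

(** The constant is the largest [S]-length of the finitely many elements of [S']. *)
Lemma word_dist_lipschitz (G : groupType) (S S' : set G) :
  finite_generating_set S -> finite_generating_set S' ->
  exists lam, forall u v, word_dist S u v <= lam * word_dist S' u v.
Proof.
move=> genS genS'; have [/finite_seqP[l S'l] _] := genS'.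
pose lam := \max_(s <- l) word_dist S 1%g s; exists lam.
have lamP s : S' s -> word_dist S 1%g s <= lam.
  by rewrite S'l => sl; rewrite /lam; apply: (leq_bigmax_seq (F := word_dist S 1%g)).
have adj u v : adjacent S' u v -> word_dist S u v <= lam.
  move=> [_ [s S's []->]].
    by rewrite -{1}(mulg1 u) word_dist_translate//; exact: lamP.
  by rewrite word_dist_sym// -{1}(mulg1 v) word_dist_translate//; exact: lamP.
move=> u v; have [w [w0 wn ws]] := word_dist_walk genS' u v.
move: (word_dist S' u v) wn ws => n; elim: n v => [|n IH] v wn ws.
  by rewrite -w0 -wn word_distxx.
apply: (leq_trans (word_dist_triangle genS (w n) _ _)); rewrite mulnS addnC -wn.
apply: leq_add; last by apply: IH => // i i_n; apply: ws; lia.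
by have [->|/adj//] := ws n (ltnSn n); rewrite word_distxx.
Qed.

(** * Thin triangles and the four-point condition *)

Local Open Scope ring_scope.

Definition pseudometric (R : realType) (X : Type) (d : X -> X -> R) : Prop :=
  [/\ forall x, d x x = 0, forall x y, d x y = d y x &
      forall x y z, d x z <= d x y + d y z].

Section Hyperbolicity.
Variables (R : realType) (X : Type) (d : X -> X -> R).
Hypothesis dP : pseudometric d.

Lemma pseudo_refl x : d x x = 0. Proof. by case: dP. Qed.
Lemma pseudo_sym x y : d x y = d y x. Proof. by case: dP. Qed.
Lemma pseudo_triangle y x z : d x z <= d x y + d y z. Proof. by case: dP. Qed.

Lemma pseudo_ge0 x y : 0 <= d x y.
Proof.
by have := pseudo_triangle y x x; rewrite pseudo_refl (pseudo_sym y); lra.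
Qed.

Lemma geodesic_level x y gamma t : geodesic d x y gamma -> 0 <= t <= d x y ->
  d x (gamma t) = t /\ d (gamma t) y = d x y - t.
Proof.
move=> [g0 g1 g] t01; have xy0 := pseudo_ge0 x y.
have := g 0 t; have := g t (d x y); rewrite g0 g1 !lexx xy0.
move=> /(_ t01 isT) -> /(_ isT t01) ->; case/andP: t01 => t0 t1.
by rewrite sub0r normrN ger0_norm// distrC ger0_norm ?subr_ge0.
Qed.

Lemma trace_between x y gamma z : geodesic d x y gamma -> trace d x y gamma z ->
  d x z + d z y = d x y.
Proof.
by move=> g [t /= t01 <-]; have [-> ->] := geodesic_level g t01; rewrite addrC subrK.
Qed.

Lemma geodesic_rev x y gamma : geodesic d x y gamma ->
  geodesic d y x (fun t => gamma (d x y - t)).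
Proof.
move=> [g0 g1 g]; rewrite /geodesic (pseudo_sym y x) subr0 subrr; split => // s t.
have flip u : 0 <= u <= d x y -> 0 <= d x y - u <= d x y.
  by move=> /andP[u0 u1]; rewrite subr_ge0 u1 lerBlDr lerDl u0.
move=> /flip st /flip tt; rewrite g//.
by rewrite opprB addrC addrA subrK distrC.
Qed.

Lemma trace_rev x y gamma :
  trace d y x (fun t => gamma (d x y - t)) = trace d x y gamma.
Proof.
have flip u : 0 <= u <= d x y -> 0 <= d x y - u <= d x y.
  by move=> /andP[u0 u1]; rewrite subr_ge0 u1 lerBlDr lerDl u0.
rewrite /trace (pseudo_sym y x); apply/seteqP; split => _ [t /= /flip t01 <-].
  by exists (d x y - t).
by exists (d x y - t) => //=; rewrite subKr.
Qed.

Lemma geodesic_const x : geodesic d x x (fun=> x).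
Proof.
rewrite /geodesic pseudo_refl; split => // s t s0 t0.
have -> : s - t = 0 by lra.
by rewrite normr0.
Qed.

(** A bigon is a triangle with a constant side at [y], and [y] already lies on [gamma']. *)
Lemma hyperbolic_bigon delta x y gamma gamma' z : delta_hyperbolic d delta ->
  geodesic d x y gamma -> geodesic d x y gamma' -> trace d x y gamma z ->
  exists2 z', trace d x y gamma' z' & d z z' < delta.
Proof.
move=> H g g' gz.
have [/(_ _ gz)[z' [[t /= t0 ty]|tz'] zz'] _ _] :=
  H _ _ _ _ _ _ g (geodesic_const y) (geodesic_rev g').
  exists z' => //; exists (d x y); last by rewrite -ty; case: g'.
  by rewrite /= lexx pseudo_ge0.
by exists z' => //; rewrite -trace_rev.
Qed.

Definition real_four_point (e : R) : Prop := forall x y z w,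
  d x z + d y w <= Num.max (d x y + d z w) (d x w + d y z) + e.

(** The four-point inequality gives a point of one side excess at most [e] over another side.
    Comparing it with the point of that side at the same distance from the common vertex costs
    another [e]; the added 1 makes the bound strict. *)
Lemma four_point_hyperbolic e : real_four_point e ->
  delta_hyperbolic d (2 * e + 1).
Proof.
move=> H.
have e0 (x : X) : 0 <= e.
  by have := H x x x x; rewrite pseudo_refl maxxx; lra.
have fp x y z w : d x z + d y w <= d x y + d z w + e \/
    d x z + d y w <= d x w + d y z + e.
  by have := H x y z w; rewrite maxEle; case: ifP => _; [right|left].
have half p q r x c : d p x + d x q = d p q -> d x r + d x q <= d q r + e ->
    geodesic d q r c -> exists2 y, trace d q r c y & d x y < 2 * e + 1.
  move=> pxq xrq gc; have e00 := e0 x; clear e0; have xr0 := pseudo_ge0 x r.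
  have xq0 := pseudo_ge0 x q; have qr0 := pseudo_ge0 q r.
  have [h|h] := leP (d x q) (d q r).
    have m01 : 0 <= d x q <= d q r by rewrite xq0.
    have [qy yr] := geodesic_level gc m01.
    exists (c (d x q)); first by exists (d x q).
    clear gc pxq H; have := fp x q (c (d x q)) r; rewrite qy yr.
    by move: (d x (c _)) => u [] ?; lra.
  (* When [x] is farther from [q] than [r] is, the comparison point is the end [r]. *)
  have m01 : 0 <= d q r <= d q r by rewrite qr0 lexx.
  have [qy yr] := geodesic_level gc m01.
  exists (c (d q r)); first by exists (d q r).
  clear gc pxq H; have := fp x q (c (d q r)) r; rewrite qy yr.
  by move: (d x (c _)) => u [] ?; lra.
clear e0.
have side x y z (a b c : R -> X) :
    geodesic d x y a -> geodesic d y z b -> geodesic d z x c ->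
    trace d x y a `<=` open_neighborhood d (2 * e + 1)
      (trace d y z b `|` trace d z x c).
  move=> ga gb gc w aw; have xwy := trace_between ga aw.
  have [h|h] := fp w x z y; last first.
    have h1 : d y w + d w x = d y x.
      by rewrite (pseudo_sym y w) (pseudo_sym w x) (pseudo_sym y x); lra.
    have h2 : d w z + d w x <= d x z + e.
      by rewrite (pseudo_sym w x); lra.
    have [v zxv wv] := half y x z w _ h1 h2 (geodesic_rev gc).
    by exists v => //; right; rewrite -trace_rev.
  have h2 : d w z + d w y <= d y z + e.
    by rewrite (pseudo_sym z y) (pseudo_sym w x) in h; lra.
  by have [v yzv wv] := half x y z w _ xwy h2 gb; exists v => //; left.
by move=> x y z a b c ga gb gc; split; apply: side.
Qed.

End Hyperbolicity.

(** * The geometric realization of the Cayley graph *)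

Section Realization.
Variables (R : realType) (G : groupType) (S : set G).

Local Notation cayley := (cayley R S).
Local Notation vertex := (vertex R S).
Local Notation cdist := (@cayley_dist R G S).

Lemma cayley_eq (x y : cayley) : sval x = sval y -> x = y.
Proof.
case: x y => [x xP] [y yP] /= e; move: xP yP; rewrite e => xP yP.
by rewrite (Prop_irrelevance xP yP).
Qed.

Lemma bary_const (u : G) (t : R) : bary u u t = bary u u 0.
Proof. by apply/funext => w; rewrite /bary; ring. Qed.

Lemma bary0 (u v : G) : bary u v 0 = bary u u 0 :> (G -> R).
Proof. by apply/funext => w; rewrite /bary; ring. Qed.

Lemma bary1 (u v : G) : bary u v 1 = bary v v 0 :> (G -> R).
Proof. by apply/funext => w; rewrite /bary; ring. Qed.

Lemma edge_segment_sym (x y : cayley) l : edge_segment x y l -> edge_segment y x l.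
Proof.
move=> [u [v [s [t [uv [s01 t01] xE yE ->]]]]]; exists u, v, t, s.
by split => //; rewrite distrC.
Qed.

Lemma edge_segment_ge0 (x y : cayley) l : edge_segment x y l -> 0 <= l.
Proof. by move=> [u [v [s [t [_ _ _ _ ->]]]]]; exact: normr_ge0. Qed.

Lemma edge_path_cat (x y z : cayley) l l' :
  edge_path x y l -> edge_path y z l' -> edge_path x z (l + l').
Proof.
move=> p; elim: p z l' => [x'|x' y' z' k k' xy _ IH] z l' q; first by rewrite add0r.
by rewrite -addrA; apply: edge_path_cons xy _; exact: IH.
Qed.

Lemma edge_path1 (x y : cayley) l : edge_segment x y l -> edge_path x y l.
Proof.
by move=> h; rewrite -(addr0 l); apply: edge_path_cons h _; exact: edge_path_nil.
Qed.

Lemma edge_path_sym (x y : cayley) l : edge_path x y l -> edge_path y x l.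
Proof.
elim=> [x'|x' y' z' k k' xy _ IH]; first exact: edge_path_nil.
by rewrite addrC; apply: edge_path_cat IH _; exact/edge_path1/edge_segment_sym.
Qed.

Lemma edge_path_ge0 (x y : cayley) l : edge_path x y l -> 0 <= l.
Proof. by elim=> // x' y' z' k k' /edge_segment_ge0 k0 _ k'0; rewrite addr_ge0. Qed.

Lemma cdist_le (x y : cayley) l : edge_path x y l -> cdist x y <= l.
Proof. by move=> h; apply: ge_inf => //; exists 0 => k /edge_path_ge0. Qed.

Lemma bary_translate (g u v : G) (t : R) :
  (fun w => bary u v t (g^-1 * w)%g) = bary (g * u)%g (g * v)%g t.
Proof.
have sh w u' : (g^-1 * w == u')%g = (w == g * u')%g.
  by rewrite -(inj_eq (mulgI g)) mulVKg.
by apply/funext => w; rewrite /bary !sh.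
Qed.

Lemma cayley_act_vertex g u : cayley_act g (vertex u) = vertex (g * u)%g.
Proof. by apply: cayley_eq => /=; rewrite bary_translate. Qed.

Lemma cayley_actM g h (x : cayley) :
  cayley_act (g * h)%g x = cayley_act g (cayley_act h x).
Proof. by apply: cayley_eq; apply/funext => w /=; rewrite invgM mulgA. Qed.

Lemma cayley_act1 (x : cayley) : cayley_act 1%g x = x.
Proof. by apply: cayley_eq; apply/funext => w /=; rewrite invg1 mul1g. Qed.

Lemma edge_path_act g (x y : cayley) l : edge_path x y l ->
  edge_path (cayley_act g x) (cayley_act g y) l.
Proof.
elim=> [x'|x' y' z' k k' xy _]; first exact: edge_path_nil.
apply: edge_path_cons.
move: xy => [u [v [s [t [uv st xE yE ->]]]]]; exists (g * u)%g, (g * v)%g, s, t.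
by split => //=; rewrite ?xE ?yE ?bary_translate//; exact: adjacent_translate.
Qed.

Lemma cdist_act g (x y : cayley) :
  cdist (cayley_act g x) (cayley_act g y) = cdist x y.
Proof.
congr (inf _); apply/seteqP; split => l /=; last exact: edge_path_act.
by move/(edge_path_act g^-1); rewrite -!cayley_actM mulVg !cayley_act1.
Qed.

Hypothesis genS : finite_generating_set S.
Local Notation wd := (word_dist S).

(* The function [x |-> min_w (wd u w + 1 - x w)], with [w] in the support of
   [x], extends the word distance from [u] as a 1-Lipschitz function. *)
Lemma edge_path_support (x y : cayley) l (u w : G) : edge_path x y l ->
  0 < sval x w -> exists2 w', 0 < sval y w' &
  (wd u w')%:R + (1 - sval y w') <= (wd u w)%:R + (1 - sval x w) + l :> R.
Proof.
move=> p; elim: p w => [x'|x' y' z' k k' xy _ IH] w xw.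
  by exists w => //; rewrite addr0.
suff [w1 yw1 h1] : exists2 w', 0 < sval y' w' &
    (wd u w')%:R + (1 - sval y' w') <= (wd u w)%:R + (1 - sval x' w) + k :> R.
  by have [w2 zw2 h2] := IH _ yw1; exists w2 => //; lra.
move: xy xw => [a [b [s [t [ab [/andP[s0 s1] /andP[t0 t1]] -> -> ->]]]]].
have dab : (wd u b)%:R <= (wd u a)%:R + 1 :> R.
  rewrite natr1 ler_nat; apply: leq_trans (word_dist_triangle genS a _ _) _.
  by rewrite -addn1 leq_add2l word_dist_adjacent.
have dba : (wd u a)%:R <= (wd u b)%:R + 1 :> R.
  rewrite natr1 ler_nat; apply: leq_trans (word_dist_triangle genS b _ _) _.
  by rewrite -addn1 leq_add2l word_dist_adjacent//; exact: adjacent_sym.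
have [ab' _] := ab; have ba' : (b == a) = false by rewrite eq_sym (negbTE ab').
have ya : bary a b t a = 1 - t by rewrite /bary eqxx (negbTE ab') mulr1 mulr0 addr0.
have yb : bary a b t b = t by rewrite /bary eqxx ba' mulr1 mulr0 add0r.
have xa : bary a b s a = 1 - s by rewrite /bary eqxx (negbTE ab') mulr1 mulr0 addr0.
have xb : bary a b s b = s by rewrite /bary eqxx ba' mulr1 mulr0 add0r.
have n1 := ler_norm (s - t); have n2 := ler_norm (t - s); rewrite distrC in n2.
have [->|wa] := eqVneq w a.
  move=> _; rewrite xa; have [t1'|t1'] := ltP t 1.
    by exists a; rewrite ya; lra.
  by exists b; rewrite yb; lra.
have [->|wb] := eqVneq w b.
  move=> _; rewrite xb; have [t0'|t0'] := ltP 0 t.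
    by exists b; rewrite yb; lra.
  by exists a; rewrite ya; lra.
by rewrite /bary (negbTE wa) (negbTE wb) !mulr0 addr0 ltxx.
Qed.

Lemma vertexE u w : sval (vertex u) w = (w == u)%:R.
Proof. by rewrite /= /bary subr0 mul1r mul0r addr0. Qed.

Lemma edge_path_vertex_ge u v l : edge_path (vertex u) (vertex v) l ->
  (wd u v)%:R <= l.
Proof.
move=> /(@edge_path_support _ _ _ u u); rewrite !vertexE eqxx => /(_ ltr01)[w].
rewrite vertexE word_distxx; case: eqP => [->|_]; last by rewrite ltxx.
by rewrite subrr add0r addr0 !add0r.
Qed.

Lemma adjacent_path u v : adjacent S u v -> edge_path (vertex u) (vertex v) 1.
Proof.
move=> uv; apply: edge_path1; exists u, v, 0, 1; split => //.
- by rewrite !lexx ler01.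
- by rewrite bary0.
- by rewrite bary1.
- by rewrite sub0r normrN normr1.
Qed.

Lemma word_dist_path u v : edge_path (vertex u) (vertex v) (wd u v)%:R.
Proof.
have [w [w0 wn wg _]] := word_dist_geodesic_steps genS (erefl (wd u v)).
rewrite -[in X in edge_path X]w0 -[in X in edge_path _ X]wn.
suff : forall n, (n <= wd u v)%N -> edge_path (vertex (w 0%N)) (vertex (w n)) n%:R.
  by apply.
elim=> [|n IH] nd; first exact: edge_path_nil.
rewrite -natr1; apply: edge_path_cat (IH (ltnW nd)) _; apply: adjacent_path.
exact: geodesic_adjacent genS wg nd.
Qed.

Lemma near_vertex (x : cayley) :
  exists u, exists2 l, edge_path x (vertex u) l & l <= 1.
Proof.
case: (svalP x) => u [v [t [[uv|uv] /andP[t0 t1] xE]]].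
  exists u, 0; last exact: ler01.
  have -> : x = vertex u by apply: cayley_eq; rewrite xE -uv bary_const.
  exact: edge_path_nil.
exists u, `|t - 0|; last by rewrite subr0 ger0_norm.
apply: edge_path1; exists u, v, t, 0; split => //; last by rewrite bary0.
by rewrite t0 t1 lexx ler01.
Qed.

Lemma edge_path_exists (x y : cayley) : exists l, edge_path x y l.
Proof.
have [u [k xu _]] := near_vertex x; have [v [l yv _]] := near_vertex y.
exists (k + ((wd u v)%:R + l)); apply: edge_path_cat xu _.
by apply: edge_path_cat (word_dist_path u v) _; exact: edge_path_sym.
Qed.

Lemma le_cdist (x y : cayley) r :
  (forall l, edge_path x y l -> r <= l) -> r <= cdist x y.
Proof. by move=> h; apply: lb_le_inf => //; exact: edge_path_exists. Qed.

Lemma cayley_pseudometric : pseudometric cdist.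
Proof.
split=> [x|x y|x y z].
- apply/eqP; rewrite eq_le cdist_le ?le_cdist//; last exact: edge_path_nil.
  by move=> l /edge_path_ge0.
- by congr (inf _); apply/seteqP; split => l; exact: edge_path_sym.
rewrite -lerBlDr; apply: le_cdist => l xy; rewrite lerBlDr -lerBlDl.
apply: le_cdist => k yz; rewrite lerBlDl; apply: cdist_le.
exact: edge_path_cat xy yz.
Qed.

Lemma cdist_vertex u v : cdist (vertex u) (vertex v) = (wd u v)%:R.
Proof.
apply/eqP; rewrite eq_le cdist_le ?le_cdist//; last exact: word_dist_path.
by move=> l; exact: edge_path_vertex_ge.
Qed.

Lemma cdist_near_vertex (x : cayley) : exists u, cdist x (vertex u) <= 1.
Proof.
by have [u [l xu l1]] := near_vertex x; exists u; apply: le_trans (cdist_le xu) l1.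
Qed.

(** * Discrete geodesics as geodesics of the realization *)

Section GeodesicPath.
Variables (n : nat) (w : nat -> G).
Hypothesis wg : discrete_geodesic wd n w.

(** The default [vertex u] makes the path defined below pass through [vertex (w k)] at every time
    [k], including [k = n], where the next value of [w] is arbitrary. *)
Let edge_point (u v : G) (t : R) : cayley :=
  if pselect (in_realization S (bary u v t)) is left e then exist _ _ e
  else vertex u.

Let edge_pointE u v t : u = v \/ adjacent S u v -> 0 <= t <= 1 ->
  sval (edge_point u v t) = bary u v t.
Proof.
by move=> uv t01; rewrite /edge_point; case: pselect => // -[]; exists u, v, t.
Qed.

Let edge_point0 u v : edge_point u v 0 = vertex u.
Proof.
by rewrite /edge_point; case: pselect => // e; apply: cayley_eq; rewrite /= bary0.
Qed.

Let edge_dist u v s t : adjacent S u v -> 0 <= s <= 1 -> 0 <= t <= 1 ->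
  cdist (edge_point u v s) (edge_point u v t) <= `|s - t|.
Proof.
move=> uv s01 t01; apply: cdist_le; apply: edge_path1; exists u, v, s, t.
by split => //; rewrite edge_pointE//; right.
Qed.

Let edge_point1 u v : adjacent S u v -> edge_point u v 1 = vertex v.
Proof.
move=> uv; apply: cayley_eq.
by rewrite edge_pointE ?bary1// ?ler01 ?lexx//; auto.
Qed.

Let path (t : R) : cayley :=
  let k := Num.truncn t in edge_point (w k) (w k.+1) (t - k%:R).

Let path_nat k : path k%:R = vertex (w k).
Proof. by rewrite /path natrK subrr edge_point0. Qed.

(** At the right end [k.+1] the truncation already selects the next edge; both descriptions give the
    same vertex there. *)
Let path_edge k s t : (k < n)%N -> k%:R <= s <= k.+1%:R -> k%:R <= t <= k.+1%:R ->
  cdist (path s) (path t) <= `|s - t|.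
Proof.
move=> kn.
have pe r : k%:R <= r <= k.+1%:R -> path r = edge_point (w k) (w k.+1) (r - k%:R).
  move=> /andP[kr]; rewrite le_eqVlt => /orP[/eqP ->|rk].
    rewrite path_nat -natrB// subSnn edge_point1//.
    exact: geodesic_adjacent genS wg kn.
  rewrite /path; suff -> : Num.truncn r = k by [].
  by apply/eqP; rewrite truncn_eq ?kr// (le_trans _ kr)// ler0n.
move=> hs ht; rewrite !pe//; apply: le_trans (edge_dist _ _ _) _.
- exact: geodesic_adjacent genS wg kn.
- by move: hs; rewrite -natr1; lra.
- by move: ht; rewrite -natr1; lra.
- by have -> : s - k%:R - (t - k%:R) = s - t by lra.
Qed.

Let path_le s t : 0 <= s -> s <= t -> t <= n%:R -> cdist (path s) (path t) <= t - s.
Proof.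
move=> s0 st tn; have tri := pseudo_triangle cayley_pseudometric.
have t0 : 0 <= t by exact: le_trans s0 st.
have [sn|sn] := ltP s n%:R; last first.
  have -> : s = t by apply/eqP; rewrite eq_le st (le_trans tn).
  by rewrite subrr (pseudo_refl cayley_pseudometric).
set i := Num.truncn s; have /andP[is1 si1] := truncn_itv s0; rewrite -/i in is1 si1.
have i_n : (i < n)%N by rewrite -(ltr_nat R) (le_lt_trans is1).
have hs : i%:R <= s <= i.+1%:R by rewrite is1 ltW.
have [ti|it] := leP t i.+1%:R.
  have := path_edge i_n hs (t := t); rewrite ti (le_trans is1 st) => /(_ isT).
  by rewrite distrC ger0_norm ?subr_ge0.
set j := Num.truncn t; have /andP[jt tj1] := truncn_itv t0; rewrite -/j in jt tj1.
have ij : (i.+1 <= j)%N by rewrite -ltnS -(ltr_nat R) (lt_trans it).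
have jn : (j <= n)%N by rewrite -(ler_nat R) (le_trans jt).
have h1 : cdist (path s) (path i.+1%:R) <= i.+1%:R - s.
  have := path_edge i_n hs (t := i.+1%:R); rewrite lexx ler_nat leqnSn => /(_ isT).
  by rewrite distrC ger0_norm ?subr_ge0// ltW.
have h2 : cdist (path i.+1%:R) (path j%:R) = j%:R - i.+1%:R.
  by rewrite !path_nat cdist_vertex wg ?natrB// ij.
have h3 : cdist (path j%:R) (path t) <= t - j%:R.
  have [jn'|nj] := ltnP j n.
    have := path_edge jn' (s := j%:R) (t := t).
    rewrite lexx ler_nat leqnSn jt (ltW tj1) => /(_ isT isT).
    by rewrite distrC ger0_norm ?subr_ge0.
  have -> : t = j%:R by apply/eqP; rewrite eq_le jt andbT (le_trans tn)// ler_nat.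
  by rewrite subrr (pseudo_refl cayley_pseudometric).
have := tri (path j%:R) (path s) (path t).
have := tri (path i.+1%:R) (path s) (path j%:R).
by lra.
Qed.

Lemma cayley_geodesic : exists gamma,
  geodesic cdist (vertex (w 0)) (vertex (w n)) gamma /\
  forall i, gamma i%:R = vertex (w i).
Proof.
exists path; split; last exact: path_nat.
have dn : cdist (vertex (w 0)) (vertex (w n)) = n%:R.
  by rewrite cdist_vertex wg ?leqnn// subn0.
have tri := pseudo_triangle cayley_pseudometric.
rewrite /geodesic dn; split; [exact: (path_nat 0)|exact: path_nat|].
(* The path is 1-Lipschitz and its ends are [n] apart, so no part of it can be shortened. *)
have ge s t : 0 <= s -> s <= t -> t <= n%:R -> cdist (path s) (path t) = t - s.
  move=> s0 st tn; apply/eqP; rewrite eq_le path_le//=.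
  have := path_le (lexx 0) s0 (le_trans st tn).
  have := path_le (le_trans s0 st) tn (lexx _).
  have := tri (path s) (path 0) (path n%:R); have := tri (path t) (path s) (path n%:R).
  by rewrite (path_nat 0) (path_nat n) dn; lra.
move=> s t /andP[s0 sn] /andP[t0 tn]; have [st|ts] := leP s t.
  by rewrite ge// distrC ger0_norm ?subr_ge0.
by rewrite (pseudo_sym cayley_pseudometric) ge ?(ltW ts)// ger0_norm ?subr_ge0// ltW.
Qed.

End GeodesicPath.

Lemma cayley_geodesic_through p a q : between wd p a q -> exists gamma,
  geodesic cdist (vertex p) (vertex q) gamma /\ gamma (wd p a)%:R = vertex a.
Proof.
move=> /(geodesic_through (word_dist_geodesic genS))[w [w0 wa wq wg]].
have [gamma [gP gE]] := cayley_geodesic wg.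
by exists gamma; rewrite -{1}w0 -{1}wq gE wa.
Qed.

Lemma hyperbolic_thin_intervals : cayley_hyperbolic R S ->
  exists delta, thin_intervals wd delta.
Proof.
move=> [delta H]; pose N := Num.truncn `|delta|.
have dN : delta < N.+1%:R.
  by apply: le_lt_trans (ler_norm _) _; have /andP[] := truncn_itv (normr_ge0 delta).
(* The excess of [a] over a side is at most twice its distance to a point [y] of that side. *)
exists (2 * N.+1)%N => p q a r paq.
have [g [gP ga]] := cayley_geodesic_through paq.
have pp x y : between wd x x y by rewrite /between word_distxx.
have [g1 [g1P _]] := cayley_geodesic_through (pp q r).
have [g2 [g2P _]] := cayley_geodesic_through (pp r p).
have ta : trace cdist (vertex p) (vertex q) g (vertex a).
  exists (wd p a)%:R => //=; rewrite ler0n cdist_vertex ler_nat.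
  by move: paq; rewrite /between => <-; rewrite leq_addr.
have tri := pseudo_triangle cayley_pseudometric.
have [/(_ _ ta)[y ty ay] _ _] := H _ _ _ _ _ _ gP g1P g2P.
have near u v :
    cdist (vertex u) y + cdist y (vertex v) = cdist (vertex u) (vertex v) ->
    (wd a u + wd a v <= wd u v + 2 * N.+1)%N.
  move=> e; rewrite -(ler_nat R) !natrD natrM -!cdist_vertex.
  have := tri y (vertex a) (vertex u); have := tri y (vertex a) (vertex v).
  have := pseudo_sym cayley_pseudometric (vertex u) y.
  by lra.
case: ty => ty; [right|left].
  exact: near (trace_between cayley_pseudometric g1P ty).
rewrite addnC (word_dist_sym genS p).
exact: near (trace_between cayley_pseudometric g2P ty).
Qed.

Lemma four_point_cayley_hyperbolic delta :
  four_point wd delta -> cayley_hyperbolic R S.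
Proof.
move=> H; pose e : R := delta%:R + 8; exists (2 * e + 1).
apply: (four_point_hyperbolic cayley_pseudometric) => x y z w.
have tri := pseudo_triangle cayley_pseudometric.
have sym := pseudo_sym cayley_pseudometric.
have close u v a b : cdist u (vertex a) <= 1 -> cdist v (vertex b) <= 1 ->
    cdist u v <= (wd a b)%:R + 2 /\ (wd a b)%:R <= cdist u v + 2.
  move=> ua vb; rewrite -cdist_vertex.
  have := tri (vertex a) u v; have := tri (vertex b) (vertex a) v.
  have := tri u (vertex a) (vertex b); have := tri v u (vertex b).
  by rewrite (sym (vertex b) v) (sym (vertex a) u); lra.
have [a xa] := cdist_near_vertex x; have [b yb] := cdist_near_vertex y.
have [c zc] := cdist_near_vertex z; have [f wf] := cdist_near_vertex w.
have [h1 _] := close _ _ _ _ xa zc; have [h2 _] := close _ _ _ _ yb wf.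
have [_ h3] := close _ _ _ _ xa yb; have [_ h4] := close _ _ _ _ zc wf.
have [_ h5] := close _ _ _ _ xa wf; have [_ h6] := close _ _ _ _ yb zc.
have : (wd a c + wd b f <= wd a b + wd c f + delta)%N \/
       (wd a c + wd b f <= wd a f + wd b c + delta)%N.
  by have := H a b c f; lia.
have l1 : cdist x y + cdist z w <=
    Num.max (cdist x y + cdist z w) (cdist x w + cdist y z).
  by rewrite le_max lexx.
have l2 : cdist x w + cdist y z <=
    Num.max (cdist x y + cdist z w) (cdist x w + cdist y z).
  by rewrite le_max lexx orbT.
by case; rewrite -(ler_nat R) !natrD /e; lra.
Qed.

End Realization.

(** * The Cotlar identity as a scalar identity *)

Section Symbols.
Variables (R : realType) (G : groupType).

Local Notation operator := (l2 R G -> l2 R G).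
Local Notation lam := (@lambda R G).

Lemma lambda_comp (g h : G) : lam g \o lam h = lam (g * h)%g.
Proof.
apply/funext => f; apply: val_inj; apply/funext => x /=.
by rewrite invgM mulgA.
Qed.

Lemma lambda_scale (g : G) (c : R[i]) (T : operator) :
  lam g \o (c *: T) = c *: (lam g \o T).
Proof. by apply/funext => f; apply: val_inj; apply/funext => x. Qed.

Lemma fourier_proj_scale (E : set G) (c : R[i]) (g : G) :
  fourier_proj E (c *: lam g) = c *: fourier_proj E (lam g).
Proof.
have := fourier_proj_sum E [:: g] (fun=> c).
by rewrite !big_seq1.
Qed.

Definition symbol (I : finType) (L : I -> set G) (eps : I -> R[i]) (g : G) : R[i] :=
  \sum_(i : I) eps i * (g \in L i)%:R.

Lemma hankel_lambda (I : finType) (L : I -> set G) eps g :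
  hankel L eps (lam g) = symbol L eps g *: lam g.
Proof.
rewrite /hankel /symbol scaler_suml; apply: eq_bigr => i _.
rewrite fourier_proj_lambda; case: ifP => _; first by rewrite mulr1.
by rewrite mulr0 scale0r scaler0.
Qed.

Lemma hankel_circ_lambda (I : finType) (L : I -> set G) eps g :
  hankel_circ L eps (lam g) = (symbol L eps g^-1%g)^* *: lam g.
Proof.
rewrite /hankel_circ /symbol rmorph_sum scaler_suml; apply: eq_bigr => i _.
rewrite fourier_proj_lambda rmorphM rmorph_nat.
suff -> : (g \in [set g' | exists2 h, L i h & g' = h^-1%g]) = (g^-1%g \in L i).
  by case: ifP => _; rewrite ?mulr1// mulr0 scale0r scaler0.
apply/idP/idP => /set_mem h; apply/mem_set.
  by case: h => h Lh ->; rewrite invgK.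
by exists g^-1%g => //; rewrite invgK.
Qed.

Lemma hankel_scale (I : finType) (L : I -> set G) eps c g :
  hankel L eps (c *: lam g) = c *: hankel L eps (lam g).
Proof.
rewrite /hankel scaler_sumr; apply: eq_bigr => i _.
by rewrite fourier_proj_scale !scalerA mulrC.
Qed.

Lemma hankel_circ_scale (I : finType) (L : I -> set G) eps c g :
  hankel_circ L eps (c *: lam g) = c *: hankel_circ L eps (lam g).
Proof.
rewrite /hankel_circ scaler_sumr; apply: eq_bigr => i _.
by rewrite fourier_proj_scale !scalerA mulrC.
Qed.

Lemma scale_lambda_inj (c c' : R[i]) g : c *: lam g = c' *: lam g -> c = c'.
Proof.
move=> /(congr1 (fun T : operator => fourier_coef T g)).
have E k : fourier_coef (k *: lam g) g = k * fourier_coef (lam g) g by [].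
by rewrite !E fourier_coef_lambda eqxx !mulr1.
Qed.

Lemma scale_comp (c : R[i]) (T T' : operator) : (c *: T) \o T' = c *: (T \o T').
Proof. by apply/funext. Qed.

Section Identity.
Variables (I : finType) (E F : I -> set G) (eps : I -> R[i]) (g h : G).

Let u := (g * h^-1)%g.
Let He := hankel E eps.
Let He' := hankel_circ E eps.
Let Ha := hankel F eps.
Let Ha' := hankel_circ F eps.
Let a := symbol E eps.
Let b := symbol F eps.

Lemma hankel_comp_lambda :
  He (lam g) \o He' (lam h^-1%g) = (a g * (a h)^*) *: lam u.
Proof.
rewrite /He /He' hankel_lambda hankel_circ_lambda invgK scale_comp lambda_scale.
by rewrite scalerA lambda_comp.
Qed.

Lemma hankel_lambda_comp (L : I -> set G) :
  Ha (lam g \o hankel_circ L eps (lam h^-1%g)) =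
  (b u * (symbol L eps h)^*) *: lam u.
Proof.
rewrite hankel_circ_lambda invgK lambda_scale lambda_comp /Ha hankel_scale.
by rewrite hankel_lambda scalerA mulrC.
Qed.

Lemma hankel_circ_lambda_comp (L : I -> set G) :
  Ha' (hankel L eps (lam g) \o lam h^-1%g) =
  ((b u^-1%g)^* * symbol L eps g) *: lam u.
Proof.
rewrite hankel_lambda scale_comp lambda_comp /Ha' hankel_circ_scale.
by rewrite hankel_circ_lambda scalerA mulrC.
Qed.

Lemma hankel_circ_hankel :
  Ha' (Ha (lam g \o lam h^-1%g)) = ((b u^-1%g)^* * b u) *: lam u.
Proof.
rewrite lambda_comp /Ha hankel_lambda /Ha' hankel_circ_scale.
by rewrite hankel_circ_lambda scalerA mulrC.
Qed.

Lemma cotlar_symbolP :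
  (He (lam g) \o He' (lam h^-1%g) =
     Ha (lam g \o Ha' (lam h^-1%g)) + Ha' (Ha (lam g) \o lam h^-1%g)
       - Ha' (Ha (lam g \o lam h^-1%g))
   /\
   Ha (lam g \o Ha' (lam h^-1%g)) + Ha' (Ha (lam g) \o lam h^-1%g)
       - Ha' (Ha (lam g \o lam h^-1%g)) =
     Ha (lam g \o He' (lam h^-1%g)) + Ha' (He (lam g) \o lam h^-1%g)
       - Ha' (Ha (lam g \o lam h^-1%g)))
  <->
  (a g * (a h)^* = b u * (b h)^* + (b u^-1%g)^* * b g - (b u^-1%g)^* * b u /\
   a g * (a h)^* = b u * (a h)^* + (b u^-1%g)^* * a g - (b u^-1%g)^* * b u).
Proof.
rewrite hankel_comp_lambda hankel_circ_hankel.
rewrite (hankel_lambda_comp F) (hankel_circ_lambda_comp F).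
rewrite (hankel_lambda_comp E) (hankel_circ_lambda_comp E).
rewrite -!scalerDl -!scalerBl.
split=> [[/scale_lambda_inj e1 /scale_lambda_inj e2]|[e1 e2]].
  by split; rewrite e1// e2.
by rewrite -e1 -e2.
Qed.

End Identity.
End Symbols.

(** * From the Cotlar property to thin triangles *)

(* Polarization: the coefficient of [x * y^*] in the sesquilinear identity. *)
Lemma sesquilinear_coef (C : numClosedFieldType)
    (g1 g2 h1 h2 u1 u2 v1 v2 : bool) :
  (forall x y : C, `|x| <= 1 -> `|y| <= 1 ->
    (x * g1%:R + y * g2%:R) * (x * h1%:R + y * h2%:R)^* =
    (x * u1%:R + y * u2%:R) * (x * h1%:R + y * h2%:R)^*
    + (x * v1%:R + y * v2%:R)^* * (x * g1%:R + y * g2%:R)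
    - (x * v1%:R + y * v2%:R)^* * (x * u1%:R + y * u2%:R)) ->
  g1 -> h2 -> u1 || v2.
Proof.
move=> H g1T h2T; apply: contraT; rewrite negb_or => /andP[/negbTE u1F /negbTE v2F].
rewrite {}g1T {}h2T {}u1F {}v2F in H.
pose Q (x y x' y' : C) :=
  (x * 1 + y * g2%:R) * (x' * h1%:R + y' * 1) -
  ((x * 0 + y * u2%:R) * (x' * h1%:R + y' * 1)
   + (x' * v1%:R + y' * 0) * (x * 1 + y * g2%:R)
   - (x' * v1%:R + y' * 0) * (x * 0 + y * u2%:R)).
have Q0 x y : `|x| <= 1 -> `|y| <= 1 -> Q x y x^* y^* = 0.
  move=> x1 y1; apply/eqP; rewrite subr_eq0; apply/eqP.
  by have := H x y x1 y1; rewrite !rmorphD !rmorphM !rmorph_nat.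
have n0 : `|0 : C| <= 1 by rewrite normr0 ler01.
have n1 : `|1 : C| <= 1 by rewrite normr1.
have ni : `|'i : C| <= 1 by rewrite normCi.
have e1 := Q0 1 0 n1 n0; have e2 := Q0 0 1 n0 n1.
have e12 := Q0 1 1 n1 n1; have ei := Q0 1 'i n1 ni.
rewrite conjC0 conjC1 in e1; rewrite conjC0 conjC1 in e2.
rewrite !conjC1 in e12; rewrite conjC1 conjCi in ei.
pose q21 : C := g2%:R * h1%:R - (u2%:R * h1%:R + v1%:R * g2%:R - v1%:R * u2%:R).
have s12 : 1 + q21 = 0.
  have <- : Q 1 1 1 1 - Q 1 0 1 0 - Q 0 1 0 1 = 1 + q21 by rewrite /Q /q21; ring.
  by rewrite e1 e2 e12 !subr0.
have si : 'i * (q21 - 1) = 0 :> C.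
  have <- : Q 1 'i 1 (- 'i) - Q 1 0 1 0 + 'i ^+ 2 * Q 0 1 0 1 = 'i * (q21 - 1).
    by rewrite /Q /q21; ring.
  by rewrite e1 e2 ei mulr0 subrr addr0.
move/eqP: si; rewrite mulf_eq0 (negbTE (neq0Ci C)) /= subr_eq0 => /eqP q1.
by move/eqP: s12; rewrite q1 -mulr2n pnatr_eq0.
Qed.

Section CotlarToThin.
Variables (R : realType) (G : groupType) (S : set G).
Hypothesis genS : finite_generating_set S.

Local Notation vertex := (vertex R S).
Local Notation cdist := (@cayley_dist R G S).
Local Notation wd := (word_dist S).
Local Notation o := (vertex 1%g).
Local Notation Lex := (L_exists cdist (@cayley_act R G S) o).
Local Notation Lall := (L_forall cdist (@cayley_act R G S) o).

Let dP := cayley_pseudometric R genS.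

Lemma act_base g : cayley_act g o = vertex g.
Proof. by rewrite cayley_act_vertex mulg1. Qed.

Lemma L_exists_between (A : set (cayley R S)) a g :
  between wd 1%g a g -> A (vertex a) -> Lex A g.
Proof.
move=> oag Aa; have [gamma [gP ga]] := cayley_geodesic_through R genS oag.
exists gamma; rewrite act_base//; exists (vertex a); split => //.
exists (wd 1%g a)%:R => //=; rewrite ler0n cdist_vertex// ler_nat.
by move: oag; rewrite /between => <-; rewrite leq_addr.
Qed.

Lemma L_forall_level (A : set (cayley R S)) rho m u : 0 < rho ->
  A `<=` metric_sphere cdist o m -> Lall rho A u ->
  exists2 a, A a & forall x, between wd 1%g x u -> wd 1%g x = m ->
    cdist (vertex x) a < 2 * rho.
Proof.
move=> rho0 Am [a Aa Ha]; exists a => // x oxu xm.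
have [gamma [gP gx]] := cayley_geodesic_through R genS oxu.
have := Ha gamma; rewrite act_base => /(_ gP)[y [[t /= t01 <-]]].
rewrite /metric_ball gt_eqF//= => ya.
have oa : cdist o a = m%:R by exact: Am.
have mu : 0 <= (m%:R : R) <= cdist o (vertex u).
  rewrite ler0n cdist_vertex// ler_nat -xm.
  by move: oxu; rewrite /between => <-; rewrite leq_addr.
have [ot _] := geodesic_level dP gP t01.
have tm : cdist (gamma t) (vertex x) < rho.
  case: gP => _ _ /(_ _ _ t01 mu); rewrite -xm gx => ->; rewrite xm.
  have := pseudo_triangle dP (gamma t) o a; have := pseudo_triangle dP a o (gamma t).
  rewrite (pseudo_sym dP a) ot oa => h1 h2.
  by rewrite ltr_norml; lra.
have := pseudo_triangle dP (gamma t) (vertex x) a.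
by rewrite (pseudo_sym dP (vertex x) (gamma t)); lra.
Qed.

Lemma L_forall_meet_close (A B : set (cayley R S)) rho m k : 0 < rho ->
  A `<=` metric_sphere cdist o m -> B `<=` metric_sphere cdist o m ->
  Lall rho A k -> Lall rho B k ->
  exists a b, [/\ A a, B b & cdist a b < 4 * rho].
Proof.
move=> rho0 Am Bm [a Aa Ha] [b Bb Hb].
have ook : between wd 1%g 1%g k by rewrite /between word_distxx.
have [gamma [gP _]] := cayley_geodesic_through R genS ook.
have := Ha gamma; have := Hb gamma; rewrite act_base => /(_ gP)[y [[t /= t01 <-]]].
rewrite /metric_ball gt_eqF//= => yb /(_ gP)[z [[s /= s01 <-]]] za.
exists a, b; split => //.
have oa : cdist o a = m%:R by exact: Am.
have ob : cdist o b = m%:R by exact: Bm.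
have [ot _] := geodesic_level dP gP t01; have [os _] := geodesic_level dP gP s01.
have ts : cdist (gamma s) (gamma t) < 2 * rho.
  case: gP => _ _ /(_ _ _ s01 t01) ->.
  have := pseudo_triangle dP (gamma t) o b; have := pseudo_triangle dP b o (gamma t).
  have := pseudo_triangle dP (gamma s) o a; have := pseudo_triangle dP a o (gamma s).
  rewrite (pseudo_sym dP a) (pseudo_sym dP b) ot os oa ob => h1 h2 h3 h4.
  by rewrite ltr_norml; lra.
have := pseudo_triangle dP (gamma s) a b.
have := pseudo_triangle dP (gamma t) (gamma s) b.
by rewrite (pseudo_sym dP a (gamma s)); lra.
Qed.

Lemma sphere_vertex a m : wd 1%g a = m -> metric_sphere cdist o m (vertex a).
Proof. by move=> am; rewrite /metric_sphere /= cdist_vertex// am. Qed.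

Variables (rho : R) (m : nat).
Hypotheses (rho0 : 0 < rho) (cot : cayley_cotlar_at S rho m).

Lemma cotlar_triangle_alt g h a c : let u := (g * h^-1)%g in
  between wd 1%g a g -> wd 1%g a = m -> between wd 1%g c h -> wd 1%g c = m ->
  2 * m%:R + 2 * rho <= (wd 1%g u)%:R :> R ->
  (forall x, between wd 1%g x u -> wd 1%g x = m ->
     cdist (vertex x) (vertex a) < 6 * rho) \/
  (forall y, between wd 1%g y u^-1%g -> wd 1%g y = m ->
     cdist (vertex y) (vertex c) < 6 * rho).
Proof.
move=> u oag am och cm ulong; have r0 : 0 < rho := rho0.
have ulong' : 2 * m%:R + 2 * rho <= cdist o (cayley_act (g * h^-1)%g o).
  by rewrite act_base cdist_vertex.
have sa := sphere_vertex am; have sc := sphere_vertex cm.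
have [disj|] := pselect (Lall rho [set vertex a] `&` Lall rho [set vertex c] = set0).
  pose A (i : bool) := if i then [set vertex a] else [set vertex c].
  have Am i : A i `<=` metric_sphere cdist o m by case: i => _ ->.
  have Ad i j : i != j -> Lall rho (A i) `&` Lall rho (A j) = set0.
    by case: i j => [] [] //= _; rewrite // setIC.
  have gU : (\bigcup_i Lex (A i)) g.
    by exists true => //; exact: L_exists_between oag _.
  have hU : (\bigcup_i Lex (A i)) h.
    by exists false => //; exact: L_exists_between och _.
  have : (u \in Lall rho (A true)) || (u^-1%g \in Lall rho (A false)).
    apply: (@sesquilinear_coef R[i] (g \in Lex (A true)) (g \in Lex (A false))
      (h \in Lex (A true)) (h \in Lex (A false)) _ (u \in Lall rho (A false))
      (u^-1%g \in Lall rho (A true))).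
    - move=> x y x1 y1; pose eps (i : bool) : R[i] := if i then x else y.
      have e1 i : `|eps i| <= 1 by case: i.
      have [_] := (cotlar_symbolP _ _ _ _ _).1 (cot Am Ad e1 gU hU ulong').
      by rewrite /symbol !big_bool.
    - by apply/mem_set; exact: L_exists_between oag _.
    - by apply/mem_set; exact: L_exists_between och _.
  case/orP => /set_mem /(L_forall_level rho0 (Am _))[_ -> H]; [left|right];
    by move=> x ox xm; have := H x ox xm; lra.
move=> ndisj.
have [k [ka kc]] : Lall rho [set vertex a] `&` Lall rho [set vertex c] !=set0.
  by apply/set0P/eqP.
have close : cdist (vertex a) (vertex c) < 4 * rho.
  have [||_ [_ [-> -> //]]] := L_forall_meet_close (m := m) rho0 _ _ ka kc.
  - by move=> _ ->.
  - by move=> _ ->.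
pose A (i : unit) := [set vertex a; vertex c].
have Am i : A i `<=` metric_sphere cdist o m by move=> _ [] ->.
have Ad i j : i != j -> Lall rho (A i) `&` Lall rho (A j) = set0.
  by case: i j => [] [].
have gE : Lex (A tt) g by apply: L_exists_between oag _; left.
have hE : Lex (A tt) h by apply: L_exists_between och _; right.
have gU : (\bigcup_i Lex (A i)) g by exists tt.
have hU : (\bigcup_i Lex (A i)) h by exists tt.
have e1 (i : unit) : `|1 : R[i]| <= 1 by rewrite normr1.
have [_] := (cotlar_symbolP _ _ _ _ _).1 (cot Am Ad e1 gU hU ulong').
have sE (L : unit -> set G) k' :
    symbol L (fun=> 1 : R[i]) k' = (k' \in L tt)%:R.
  by rewrite /symbol (bigD1 tt)//= mul1r big1 ?addr0// => -[].
rewrite {e1}!sE (mem_set gE) (mem_set hE) !conjC_nat -/u.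
have [/set_mem uF _|_] := boolP (u \in Lall rho (A tt)).
  left=> x ox xm; have [b Ab /(_ x ox xm) xb] := L_forall_level rho0 (Am tt) uF.
  have := pseudo_triangle dP (vertex c) (vertex x) (vertex a).
  by case: Ab xb => ->; rewrite (pseudo_sym dP (vertex c) (vertex a)); lra.
have [/set_mem uF _|_] := boolP (u^-1%g \in Lall rho (A tt)).
  right=> x ox xm; have [b Ab /(_ x ox xm) xb] := L_forall_level rho0 (Am tt) uF.
  have := pseudo_triangle dP (vertex a) (vertex x) (vertex c).
  by case: Ab xb => ->; lra.
by rewrite !mul0r addr0 subr0 mulr1 => /eqP; rewrite oner_eq0.
Qed.

Lemma between_translate g p x q :
  between wd (g * p)%g (g * x)%g (g * q)%g <-> between wd p x q.
Proof. by rewrite /between !word_dist_translate. Qed.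

Lemma cotlar_base_alternative (C : nat) : 6 * rho <= C%:R -> base_alternative wd C m.
Proof.
move=> Crho p q r a c pq par am qcr cm; have r0 : 0 < rho := rho0.
have tr (x y z : G) : between wd x y z -> between wd 1%g (x^-1 * y)%g (x^-1 * z)%g.
  by rewrite -(between_translate x^-1) mulVg.
have dtr x y : wd 1%g (x^-1 * y)%g = wd x y.
  by rewrite -(word_dist_translate genS x^-1 x) mulVg.
have uE : (p^-1 * r * (q^-1 * r)^-1 = p^-1 * q)%g by rewrite invgM invgK mulgA mulgK.
have uE' : ((p^-1 * q)^-1 = q^-1 * p)%g by rewrite invgM invgK.
have := @cotlar_triangle_alt (p^-1 * r)%g (q^-1 * r)%g (p^-1 * a)%g (q^-1 * c)%g.
rewrite /= uE uE' !dtr => /(_ (tr _ _ _ par) am (tr _ _ _ qcr) cm).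
have le : 2 * m%:R + 2 * rho <= (wd p q)%:R :> R.
  move: pq; rewrite -(ler_nat R) natrD natrM; lra.
move=> /(_ le)[H|H]; [left|right].
  move=> x pxq xm; have := H (p^-1 * x)%g (tr _ _ _ pxq).
  rewrite dtr => /(_ xm); rewrite cdist_vertex// word_dist_translate// => h.
  by rewrite -(ler_nat R); lra.
move=> y /(between_sym (word_dist_geodesic genS)) qyp ym.
have := H (q^-1 * y)%g (tr _ _ _ qyp).
rewrite dtr => /(_ ym); rewrite cdist_vertex// word_dist_translate// => h.
by rewrite -(ler_nat R); lra.
Qed.

End CotlarToThin.

(** * From thin triangles to the Cotlar property *)

Lemma symbol_unique (R : realType) (G : groupType) (I : finType)
    (L : I -> set G) (eps : I -> R[i]) g i :
  L i g -> (forall j, i != j -> ~ L j g) -> symbol L eps g = eps i.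
Proof.
move=> Lig Ljg; rewrite /symbol (bigD1 i)//= mem_set// mulr1 big1 ?addr0// => j ji.
by rewrite memNset ?mulr0//; apply: Ljg; rewrite eq_sym.
Qed.

Section HyperbolicToCotlar.
Variables (R : realType) (G : groupType) (S : set G).
Hypothesis genS : finite_generating_set S.

Local Notation vertex := (vertex R S).
Local Notation cdist := (@cayley_dist R G S).
Local Notation act := (@cayley_act R G S).
Local Notation o := (vertex 1%g).
Local Notation Lex := (L_exists cdist act o).
Local Notation Lall := (L_forall cdist act o).

Let dP := cayley_pseudometric R genS.

Lemma cayley_geodesic_exists u v :
  exists gamma, geodesic cdist (vertex u) (vertex v) gamma.
Proof.
have [|gamma [gP _]] := @cayley_geodesic_through R G S genS u u v; last by exists gamma.
by rewrite /between word_distxx.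
Qed.

Lemma geodesic_act g x y gamma : geodesic cdist x y gamma ->
  geodesic cdist (act g x) (act g y) (act g \o gamma).
Proof.
move=> [g0 g1 gg]; rewrite /geodesic cdist_act /= g0 g1; split => // s t ss tt.
by rewrite cdist_act gg.
Qed.

Lemma trace_act g x y gamma z : trace cdist x y gamma z ->
  trace cdist (act g x) (act g y) (act g \o gamma) (act g z).
Proof. by move=> [t /= t01 <-]; exists t; rewrite //= cdist_act. Qed.

Variable delta : R.
Hypothesis hyp : delta_hyperbolic cdist delta.

Lemma hyperbolic_delta_gt0 : 0 < delta.
Proof.
have g := geodesic_const dP o.
have to : trace cdist o o (fun=> o) o by exists 0; rewrite //= lexx (pseudo_ge0 dP).
have [y _ oy] := hyperbolic_bigon dP hyp g g to.
exact: le_lt_trans (pseudo_ge0 dP _ _) oy.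
Qed.

Let rho := 2 * delta.

Let in_ball x y : cdist x y < rho -> metric_ball cdist rho y x.
Proof.
by rewrite /metric_ball gt_eqF// /rho; have := hyperbolic_delta_gt0; lra.
Qed.

Lemma near_geodesic_L_forall A a u eta z : A a ->
  geodesic cdist o (act u o) eta -> trace cdist o (act u o) eta z ->
  cdist a z < delta -> Lall rho A u.
Proof.
move=> Aa eP ez az; exists a => // eta' e'P.
have [z' ez' zz'] := hyperbolic_bigon dP hyp eP e'P ez.
exists z'; split => //; apply: in_ball.
have := pseudo_triangle dP z z' a.
by rewrite (pseudo_sym dP z' z) (pseudo_sym dP z a) /rho; lra.
Qed.

Lemma L_exists_forall A : Lex A `<=` Lall rho A.
Proof.
move=> g [gamma gP [a [ga Aa]]]; apply: near_geodesic_L_forall Aa gP ga _.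
by rewrite (pseudo_refl dP) hyperbolic_delta_gt0.
Qed.

Lemma hyperbolic_triangle_alt m A B g h : let u := (g * h^-1)%g in
  A `<=` metric_sphere cdist o m -> B `<=` metric_sphere cdist o m ->
  Lex A g -> Lex B h -> 2 * m%:R + 2 * rho <= cdist o (act u o) ->
  Lall rho A u \/ Lall rho B u^-1%g.
Proof.
move=> u Am Bm [al alP [x [alx Ax]]] [be0 be0P [y0 [bey0 By0]]] ulong.
have uhg : act u (act h o) = act g o by rewrite -cayley_actM /u -mulgA mulVg mulg1.
have beP := geodesic_act u be0P; have bey := trace_act u bey0.
rewrite uhg in beP bey.
have [eta] := cayley_geodesic_exists 1%g u; rewrite -[vertex u]act_base => eP.
have uu : act u (act u^-1%g o) = o by rewrite -cayley_actM mulgV cayley_act1.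
have [/(_ _ alx)[b' tb xb] H2 _] := hyp alP (geodesic_rev dP beP) (geodesic_rev dP eP).
rewrite !(trace_rev dP) in H2 tb.
have [a' ta ya] := H2 _ bey.
case: tb => [tb|tb]; last by left; exact: near_geodesic_L_forall Ax eP tb xb.
case: ta => [ta|ta].
  right; have := trace_act u^-1%g ta.
  have := geodesic_act u^-1%g eP.
  rewrite -!cayley_actM mulVg cayley_act1 => e'P ta'.
  have ya' : cdist y0 (act u^-1%g a') < delta.
    by rewrite -(cdist_act u) -cayley_actM mulgV cayley_act1.
  have e'' := geodesic_rev dP e'P.
  by apply: near_geodesic_L_forall By0 e'' _ ya'; rewrite trace_rev.
have ox : cdist o x = m%:R by exact: Am.
have uy : cdist (act u o) (act u y0) = m%:R by rewrite cdist_act; exact: Bm.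
have tri := pseudo_triangle dP; have sym := pseudo_sym dP.
have := trace_between dP alP alx; have := trace_between dP alP ta.
have := trace_between dP beP bey; have := trace_between dP beP tb.
have := tri b' x (act g o); have := tri a' (act u y0) (act g o).
have := tri x o (act u o); have := tri b' x (act u o).
have := tri a' o (act u o); have := tri (act u y0) a' (act u o).
rewrite (sym b' (act u o)) (sym a' (act u y0)) (sym (act u y0) (act u o)).
have d0 := hyperbolic_delta_gt0; rewrite ox uy; rewrite /rho in ulong.
by lra.
Qed.

Lemma hyperbolic_cotlar : cayley_cotlar S rho.
Proof.
move=> m I A eps Am Ad _ g h [i _ gi] [j _ hj] ulong.
apply/cotlar_symbolP.
have uniq k l : Lex (A l) k -> forall l', l != l' -> ~ Lall rho (A l') k.
  move=> /L_exists_forall kl l' ll' kl'.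
  by have : (Lall rho (A l) `&` Lall rho (A l')) k by []; rewrite Ad.
have E k l : Lex (A l) k -> symbol (fun i => Lex (A i)) eps k = eps l.
  move=> kl; apply: symbol_unique => // l' ll' /L_exists_forall.
  exact: uniq kl _ ll'.
have F k l : Lall rho (A l) k -> symbol (fun i => Lall rho (A i)) eps k = eps l.
  move=> kl; apply: symbol_unique => // l' ll' kl'.
  by have : (Lall rho (A l) `&` Lall rho (A l')) k by []; rewrite Ad.
rewrite (E _ _ gi) (E _ _ hj) (F _ _ (L_exists_forall gi))
  (F _ _ (L_exists_forall hj)).
have [/F ->|/F ->] := hyperbolic_triangle_alt (Am i) (Am j) gi hj ulong.
  by split; ring.
by split; ring.
Qed.

End HyperbolicToCotlar.

Lemma cayley_hyperbolic_cotlar (R : realType) (G : groupType) (S : set G) :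
  finite_generating_set S -> cayley_hyperbolic R S ->
  exists rho : R, 0 < rho /\ cayley_cotlar S rho.
Proof.
move=> genS [delta H]; exists (2 * delta); split; last exact: hyperbolic_cotlar.
by rewrite mulr_gt0// (hyperbolic_delta_gt0 genS H).
Qed.

Lemma hyperbolic_group_cayley (R : realType) (G : groupType) (S : set G) :
  hyperbolic_group R G -> finite_generating_set S -> cayley_hyperbolic R S.
Proof.
move=> [S' genS' /(hyperbolic_thin_intervals genS')[delta thin]] genS.
have dP := word_dist_geodesic genS; have d'P := word_dist_geodesic genS'.
have [l1 H1] := word_dist_lipschitz genS genS'.
have [l2 H2] := word_dist_lipschitz genS' genS.
have le u v : (word_dist S u v <= (l1 + l2) * word_dist S' u v)%N.
  by apply: leq_trans (H1 u v) _; rewrite leq_mul2r leq_addr orbT.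
have le' u v : (word_dist S' u v <= (l1 + l2) * word_dist S u v)%N.
  by apply: leq_trans (H2 u v) _; rewrite leq_mul2r leq_addl orbT.
have [delta' thin'] := quasi_isometry_thin d'P dP le' le (thin_four_point d'P thin).
exact: four_point_cayley_hyperbolic genS _ (thin_four_point dP thin').
Qed.

Lemma cotlar_sequence_hyperbolic (R : realType) (G : groupType) (S : set G)
    (rho : R) (m : nat -> nat) (K : nat) :
  finite_generating_set S -> 0 < rho -> (forall k, 0 < m k)%N ->
  (forall k, m k < m k.+1)%N -> (forall k, m k.+1 <= K * m k)%N ->
  (forall k, cayley_cotlar_at S rho (m k)) -> cayley_hyperbolic R S.
Proof.
move=> genS rho0 m0 minc mK cot; have dP := word_dist_geodesic genS.
have mk k : (k <= m k)%N.
  by elim: k => // k IH; apply: leq_ltn_trans IH (minc k).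
have m0k k : (m 0 <= m k)%N.
  by elim: k => // k IH; apply: leq_trans IH (ltnW (minc k)).
pose C := (Num.truncn (6 * rho)).+1.
have r0 : 0 <= 6 * rho by rewrite mulr_ge0// ltW.
have CP : 6 * rho <= C%:R by have /andP[_ /ltW] := truncn_itv r0.
have [|||delta thin] := @base_alternative_thin _ _ dP C (5 * K)
  (fun l => exists k, m k = l).
- by move=> _ [k <-]; exact: cotlar_base_alternative (cot k) _ CP.
- move=> _ [k <-].
  have ex : exists j, (5 * m k <= m j)%N by exists (5 * m k)%N; exact: mk.
  case: (ex_minnP ex) => -[|j] h jmin; first by have := m0k k; have := m0 k; lia.
  exists (m j.+1); first by exists j.+1.
  have : (m j < 5 * m k)%N.
    by rewrite ltnNge; apply/negP => /jmin; rewrite ltnn.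
  have := mK j; rewrite h /= => a b; apply: leq_trans a _.
  by rewrite mulnAC [leqRHS]mulnC leq_mul2l ltnW ?orbT.
- by move=> n; exists (m n) => //; exists n.
exact: four_point_cayley_hyperbolic genS _ (thin_four_point dP thin).
Qed.

Theorem corollary4p5 (R : realType) (G : groupType)
    (fgG : finitely_generated G) :
  [/\ hyperbolic_group R G <->
        (exists S : set G, finite_generating_set S /\
           exists rho : R, 0 < rho /\ cayley_cotlar S rho),
      hyperbolic_group R G <->
        (forall S : set G, finite_generating_set S ->
           exists rho : R, 0 < rho /\ cayley_cotlar S rho) &
      forall (S : set G) (rho : R) (m : nat -> nat),
        finite_generating_set S -> 0 < rho ->
        (forall k, 0 < m k)%N ->
        (forall k, m k < m k.+1)%N ->
        m @ \oo --> \oo ->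
        has_ubound (range (fun k => (m k.+1)%:R / (m k)%:R : R)) ->
        (forall k, cayley_cotlar_at S rho (m k)) ->
        hyperbolic_group R G].
Proof.
have fwd (S : set G) : hyperbolic_group R G -> finite_generating_set S ->
    exists rho : R, 0 < rho /\ cayley_cotlar S rho.
  move=> hG genS.
  exact: cayley_hyperbolic_cotlar genS (hyperbolic_group_cayley hG genS).
have bwd (S : set G) (rho : R) : finite_generating_set S -> 0 < rho ->
    cayley_cotlar S rho -> hyperbolic_group R G.
  move=> genS rho0 cot; exists S => //.
  apply: (@cotlar_sequence_hyperbolic _ _ _ rho succn 2) => // k; last exact: cot.
  by rewrite mul2n -addnn addSn ltnS leq_addl.
split.
- split=> [hG|[S [genS [rho [rho0 cot]]]]]; last exact: bwd genS rho0 cot.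
  by have [S genS] := fgG; exists S; split => //; exact: fwd.
- split=> [hG S|H]; first exact: fwd.
  by have [S genS] := fgG; have [rho [rho0 cot]] := H S genS; exact: bwd genS rho0 cot.
move=> S rho m genS rho0 m0 minc _ [b bP] cot; exists S => //.
apply: (@cotlar_sequence_hyperbolic R G S rho m (Num.truncn `|b|).+1) => // k.
have mk0 : 0 < (m k)%:R :> R by rewrite ltr0n.
have : (m k.+1)%:R / (m k)%:R <= b by apply: bP; exists k.
rewrite ler_pdivrMr// => h; rewrite -(ler_nat R) natrM; apply: le_trans h _.
rewrite ler_pM2r//; apply: le_trans (ler_norm _) _; apply: ltW.
by have /andP[] := truncn_itv (normr_ge0 b).
Qed.
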